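(* Assume (S), (A1), (A2), (A3) with $\chi>0$. Run FedSim for $T\ge1$ rounds with $\tau\ge1$ local steps and step sizes $\gamma_u=\eta/(L_u\tau)$, $\gamma_v=\eta/(L_v\tau)$, where $$\eta\le\min\Big\{\frac{1}{12(1+\chi^2)(1+\rho^2)},\ \sqrt{\frac{m/n}{196(1-\tau^{-1})(1+\chi^2)(1+\rho^2)}}\Big\}$$ (the second term is $+\infty$ when $\tau=1$). Then there is an absolute constant $C>0$ such that $$\frac1T\sum_{t=0}^{T-1}\Big(\frac1{L_u}\mathbb E\big[\Delta_u^{(t)}\big]+\frac{m}{nL_v}\mathbb E\big[\Delta_v^{(t)}\big]\Big)\le C\Big(\frac{\Delta F_0}{\eta T}+\eta\,\sigma_{\mathrm{sim},1}^2+\eta^2\sigma_{\mathrm{sim},2}^2\Big),$$ where $\sigma_{\mathrm{sim},1}^2=(1+\chi^2)\big(\frac{\delta^2}{L_u}(1-\frac mn)+\frac{\sigma_u^2}{L_u}+\frac{\sigma_v^2m}{L_vn}\big)$ and $\sigma_{\mathrm{sim},2}^2=(1+\chi^2)\big(\frac{\delta^2}{L_u}+\frac{\sigma_u^2}{L_u}+\frac{\sigma_v^2}{L_v}\big)(1-\tau^{-1})$.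
   Context: (S) Setup. There are $n\ge2$ devices. Device $i$ has a data distribution $\mathcal D_i$ on a space $\mathcal Z$ and a continuously differentiable loss $F_i:\mathbb R^{d_0}\times\mathbb R^{d_i}\to\mathbb R$, $(u,v_i)\mapsto F_i(u,v_i)$; $u$ are shared parameters, $v_i$ personal parameters. Write $V=(v_1,\dots,v_n)$ and $F(u,V)=\frac1n\sum_{i=1}^nF_i(u,v_i)$, assumed bounded below by $F^\star$. There are stochastic gradient maps $G_{i,u}(u,v_i,z)$, $G_{i,v}(u,v_i,z)$. Fix integers $1\le m\le n$, $T\ge1$. FedSim (with local step count $\tau\ge1$ and step sizes $\gamma_u,\gamma_v>0$): start from $(u^{(0)},V^{(0)})$. In round $t=0,\dots,T-1$, a set $S^{(t)}$ of $m$ devices is sampled uniformly at random without replacement from $\{1,\dots,n\}$ (independently across rounds). Each $i\in S^{(t)}$ sets $u_{i,0}=u^{(t)}$, $v_{i,0}=v_i^{(t)}$ and for $k=0,\dots,\tau-1$ draws a fresh independent $z_{i,k}\sim\mathcal D_i$ and sets $v_{i,k+1}=v_{i,k}-\gamma_vG_{i,v}(u_{i,k},v_{i,k},z_{i,k})$, $u_{i,k+1}=u_{i,k}-\gamma_uG_{i,u}(u_{i,k},v_{i,k},z_{i,k})$; then $v_i^{(t+1)}=v_{i,\tau}$. Devices $i\notin S^{(t)}$ keep $v_i^{(t+1)}=v_i^{(t)}$. The server sets $u^{(t+1)}=\frac1m\sum_{i\in S^{(t)}}u_{i,\tau}$. (A1) Smoothness: for every $i$, $u\mapsto\nabla_uF_i(u,v_i)$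 is $L_u$-Lipschitz, $v_i\mapsto\nabla_vF_i(u,v_i)$ is $L_v$-Lipschitz, $v_i\mapsto\nabla_uF_i(u,v_i)$ is $L_{uv}$-Lipschitz, $u\mapsto\nabla_vF_i(u,v_i)$ is $L_{vu}$-Lipschitz, and $\max\{L_{uv},L_{vu}\}\le\chi\sqrt{L_uL_v}$. (A2) Bounded variance: for all $i,u,v_i$, $\mathbb E_{z\sim\mathcal D_i}G_{i,u}(u,v_i,z)=\nabla_uF_i(u,v_i)$, $\mathbb E_{z\sim\mathcal D_i}G_{i,v}(u,v_i,z)=\nabla_vF_i(u,v_i)$, $\mathbb E\|G_{i,u}(u,v_i,z)-\nabla_uF_i(u,v_i)\|^2\le\sigma_u^2$, $\mathbb E\|G_{i,v}(u,v_i,z)-\nabla_vF_i(u,v_i)\|^2\le\sigma_v^2$. (A3) Partial gradient diversity: for all $u,V$, $\frac1n\sum_{i=1}^n\|\nabla_uF_i(u,v_i)-\nabla_uF(u,V)\|^2\le\delta^2+\rho^2\|\nabla_uF(u,V)\|^2$. Notation: $\Delta F_0=F(u^{(0)},V^{(0)})-F^\star$, $\Delta_u^{(t)}=\|\nabla_uF(u^{(t)},V^{(t)})\|^2$, $\Delta_v^{(t)}=\frac1n\sum_{i=1}^n\|\nabla_vF_i(u^{(t)},v_i^{(t)})\|^2$; expectations are over all randomness. *)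

(* Defs.v *)
From HB Require Import structures.
From mathcomp Require Import all_boot all_order all_algebra.
From mathcomp Require Import all_classical all_reals all_analysis.
Set Implicit Arguments. Unset Strict Implicit. Unset Printing Implicit Defensive.
Import Order.TTheory GRing.Theory Num.Theory.
Import numFieldNormedType.Exports.
Local Open Scope classical_set_scope.
Local Open Scope ring_scope.

Definition sqnorm {R : realType} {d : nat} (x : 'rV[R]_d) : R :=
  \sum_(j < d) x 0 j ^+ 2.
Definition enorm {R : realType} {d : nat} (x : 'rV[R]_d) : R :=
  Num.sqrt (sqnorm x).
Definition dotv {R : realType} {d : nat} (x y : 'rV[R]_d) : R :=
  \sum_(j < d) x 0 j * y 0 j.

(** Conversion from tuples (which carry the product = Borel sigma-algebra of
   R^d in mathcomp-analysis) to row vectors, used to state joint measurability. *)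
Definition t2rv {R : realType} {d : nat} (t : d.-tuple R) : 'rV[R]_d :=
  \row_(j < d) tnth t j.


Definition mutually_independent {d : measure_display} {Omega : measurableType d}
  {R : realType} (P : probability Omega R) {I : eqType}
  (E : I -> set (set Omega)) : Prop :=
  forall (js : seq I), uniq js ->
  forall A : I -> set Omega, (forall j, j \in js -> E j (A j)) ->
  P (\bigcap_(j in [set j | j \in js]) A j) = (\prod_(j <- js) P (A j))%E.

Definition rv_events {Omega T : Type} (X : Omega -> T) (meas : set (set T))
  : set (set Omega) := [set X @^-1` B | B in meas].

(** State of FedSim: shared parameters u and personal parameters V = (v_i)_i,
   with v_i of dimension dv i. *)
Definition fstate (R : realType) (n d0 : nat) (dv : 'I_n -> nat) : Type :=
  ('rV[R]_d0 * (forall i : 'I_n, 'rV[R]_(dv i)))%type.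
Arguments fstate : clear implicits.

Fixpoint local_iter {R : realType} {Z : Type} {d0 dvi : nat}
  (Gu : 'rV[R]_d0 -> 'rV[R]_dvi -> Z -> 'rV[R]_d0)
  (Gv : 'rV[R]_d0 -> 'rV[R]_dvi -> Z -> 'rV[R]_dvi)
  (gamu gamv : R) (zs : nat -> Z) (uv : 'rV[R]_d0 * 'rV[R]_dvi) (k : nat)
  : 'rV[R]_d0 * 'rV[R]_dvi :=
  match k with
  | 0 => uv
  | k'.+1 =>
      let p := local_iter Gu Gv gamu gamv zs uv k' in
      (p.1 - gamu *: Gu p.1 p.2 (zs k'), p.2 - gamv *: Gv p.1 p.2 (zs k'))
  end.

Definition fedsim_round {R : realType} {Z : Type} {n d0 : nat} {dv : 'I_n -> nat}
  (Gu : forall i : 'I_n, 'rV[R]_d0 -> 'rV[R]_(dv i) -> Z -> 'rV[R]_d0)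
  (Gv : forall i : 'I_n, 'rV[R]_d0 -> 'rV[R]_(dv i) -> Z -> 'rV[R]_(dv i))
  (m tau : nat) (gamu gamv : R) (S : {set 'I_n}) (zs : 'I_n -> nat -> Z)
  (s : fstate R n d0 dv) : fstate R n d0 dv :=
  ((m%:R)^-1 *: \sum_(i in S)
      (local_iter (Gu i) (Gv i) gamu gamv (zs i) (s.1, s.2 i) tau).1,
   fun i => if i \in S
            then (local_iter (Gu i) (Gv i) gamu gamv (zs i) (s.1, s.2 i) tau).2
            else s.2 i).

Fixpoint fedsim_traj {R : realType} {Z : Type} {n d0 : nat} {dv : 'I_n -> nat}
  (Gu : forall i : 'I_n, 'rV[R]_d0 -> 'rV[R]_(dv i) -> Z -> 'rV[R]_d0)
  (Gv : forall i : 'I_n, 'rV[R]_d0 -> 'rV[R]_(dv i) -> Z -> 'rV[R]_(dv i))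
  (m tau : nat) (gamu gamv : R) (Ssel : nat -> {set 'I_n})
  (zs : nat -> 'I_n -> nat -> Z) (s0 : fstate R n d0 dv) (t : nat)
  : fstate R n d0 dv :=
  match t with
  | 0 => s0
  | t'.+1 => fedsim_round Gu Gv m tau gamu gamv (Ssel t') (zs t')
               (fedsim_traj Gu Gv m tau gamu gamv Ssel zs s0 t')
  end.

Definition Fobj {R : realType} {n d0 : nat} {dv : 'I_n -> nat}
  (F : forall i : 'I_n, 'rV[R]_d0 -> 'rV[R]_(dv i) -> R)
  (u : 'rV[R]_d0) (V : forall i : 'I_n, 'rV[R]_(dv i)) : R :=
  (n%:R)^-1 * \sum_(i < n) F i u (V i).

Definition gradFu {R : realType} {n d0 : nat} {dv : 'I_n -> nat}
  (gu : forall i : 'I_n, 'rV[R]_d0 -> 'rV[R]_(dv i) -> 'rV[R]_d0)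
  (u : 'rV[R]_d0) (V : forall i : 'I_n, 'rV[R]_(dv i)) : 'rV[R]_d0 :=
  (n%:R)^-1 *: \sum_(i < n) gu i u (V i).

Definition Delta_u {R : realType} {n d0 : nat} {dv : 'I_n -> nat}
  (gu : forall i : 'I_n, 'rV[R]_d0 -> 'rV[R]_(dv i) -> 'rV[R]_d0)
  (s : fstate R n d0 dv) : R := sqnorm (gradFu gu s.1 s.2).

Definition Delta_v {R : realType} {n d0 : nat} {dv : 'I_n -> nat}
  (gv : forall i : 'I_n, 'rV[R]_d0 -> 'rV[R]_(dv i) -> 'rV[R]_(dv i))
  (s : fstate R n d0 dv) : R :=
  (n%:R)^-1 * \sum_(i < n) sqnorm (gv i s.1 (s.2 i)).

(* Main.v *)
(** The argument is pathwise until the last step.  For a fixed state and fixed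
   samples, unrolling the local iterations bounds the client drift by the squared
   gradients plus the squared gradient noises, and smoothness together with the
   variance of the mean of a sample without replacement gives a one-round descent
   inequality that is averaged over the selected set only ([round_avg]).  Its noise
   terms are linear or quadratic in the errors of the stochastic gradients, so only
   mean zero and the variance bound are needed: the crude bound
   [|sum_k xi_k|^2 <= tau sum_k |xi_k|^2] suffices, and no orthogonality between
   local steps or between devices is used.

   Expectations are taken by decoupling: for independent sub-sigma-algebras [A] and
   [B] of [Omega], the diagonal [w |-> (w, w)] pushes [P] forward to the product of
   its restrictions to [A] and [B], so an integral of [f (w, w)] is an iterated
   integral of [f (w, w')].  Applied to past/current round, samples/selection and
   earlier/current local step, this freezes the state and replaces conditional
   expectations. *)
Require Import Defs.
From HB Require Import structures.
From mathcomp Require Import all_boot all_order all_algebra.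
From mathcomp Require Import all_classical all_reals all_analysis.
From mathcomp Require Import measurable_realfun.
From mathcomp Require Import zify ring lra.
Set Implicit Arguments. Unset Strict Implicit. Unset Printing Implicit Defensive.
Import Order.TTheory GRing.Theory Num.Theory.
Import numFieldNormedType.Exports.
Local Open Scope classical_set_scope.
Local Open Scope ring_scope.

(** * Euclidean vectors and the descent lemma *)

(** A sample exists for every device in every round, so local runs are defined for unselected
    devices too. Selection only decides which finished runs are used, and one can average over it
    with the samples fixed. Inside a round the iterates depend on the noise. Young's inequality
    separates the drift from the linear terms, so these pair the noise only with gradients at the
    start of the round, which are constants once the state is frozen. The drift is paid for in
    squared quantities; its factor [1 - 1/tau] appears because every local gradient is taken after
    at most [tau - 1] steps. Displacements are measured by [Lu |du|^2 + Lv |dv|^2]: in this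
    weighting the cross-Lipschitz bound costs only the factor [K = 1 + chi^2], for both blocks
    alike. Since [F - Fstar] is nonnegative, expectations of losses and squared norms live in the
    extended reals and Tonelli applies directly; the only signed integrals are those of the linear
    noise. *)

Section vectors.
Context {R : realType} {d : nat}.
Implicit Types (x y z : 'rV[R]_d) (a b : R).

Lemma sqnorm_ge0 x : 0 <= sqnorm x.
Proof. by apply: sumr_ge0 => j _; exact: sqr_ge0. Qed.

Lemma sqnormE x : sqnorm x = dotv x x.
Proof. by apply: eq_bigr => j _; rewrite expr2. Qed.

Lemma sqnorm0 : sqnorm (0 : 'rV[R]_d) = 0.
Proof. by apply: big1 => j _; rewrite mxE expr0n. Qed.

Lemma sqnormZ a x : sqnorm (a *: x) = a ^+ 2 * sqnorm x.
Proof. by rewrite /sqnorm mulr_sumr; apply: eq_bigr => j _; rewrite mxE exprMn. Qed.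

Lemma sqnormN x : sqnorm (- x) = sqnorm x.
Proof. by rewrite -scaleN1r sqnormZ sqrrN expr1n mul1r. Qed.

Lemma dotvDl x y z : dotv (x + y) z = dotv x z + dotv y z.
Proof. by rewrite /dotv -big_split; apply: eq_bigr => j _; rewrite mxE mulrDl. Qed.

Lemma dotvDr x y z : dotv z (x + y) = dotv z x + dotv z y.
Proof. by rewrite /dotv -big_split; apply: eq_bigr => j _; rewrite mxE mulrDr. Qed.

Lemma dotvZl a x y : dotv (a *: x) y = a * dotv x y.
Proof. by rewrite /dotv mulr_sumr; apply: eq_bigr => j _; rewrite mxE mulrA. Qed.

Lemma dotvZr a x y : dotv x (a *: y) = a * dotv x y.
Proof. by rewrite /dotv mulr_sumr; apply: eq_bigr => j _; rewrite mxE; ring. Qed.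

Lemma dotvNl x y : dotv (- x) y = - dotv x y.
Proof. by rewrite -scaleN1r dotvZl mulN1r. Qed.

Lemma dotvNr x y : dotv x (- y) = - dotv x y.
Proof. by rewrite -scaleN1r dotvZr mulN1r. Qed.

Lemma dotvBl x y z : dotv (x - y) z = dotv x z - dotv y z.
Proof. by rewrite dotvDl dotvNl. Qed.

Lemma dotv0r x : dotv x 0 = 0.
Proof. by rewrite -(scale0r 0) dotvZr mul0r. Qed.

Lemma dotv0l x : dotv 0 x = 0.
Proof. by rewrite -(scale0r 0) dotvZl mul0r. Qed.

Lemma dotv_suml I (r : seq I) (p : pred I) (f : I -> 'rV[R]_d) x :
  dotv (\sum_(i <- r | p i) f i) x = \sum_(i <- r | p i) dotv (f i) x.
Proof.
by elim/big_rec2 : _ => [|i u v _ <-]; rewrite ?dotv0l// dotvDl.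
Qed.

Lemma dotv_sumr I (r : seq I) (p : pred I) (f : I -> 'rV[R]_d) x :
  dotv x (\sum_(i <- r | p i) f i) = \sum_(i <- r | p i) dotv x (f i).
Proof.
by elim/big_rec2 : _ => [|i u v _ <-]; rewrite ?dotv0r// dotvDr.
Qed.

(** The weight stays free: [a = 1/4] leaves [3/4] of a squared gradient when the drift is split off,
    and weights built from a smoothness constant replace Cauchy-Schwarz in the descent lemmas. *)
Lemma dotv_young x y a : 0 < a -> dotv x y <= a * sqnorm x + (4 * a)^-1 * sqnorm y.
Proof.
move=> a0; rewrite /dotv /sqnorm !mulr_sumr -big_split/=; apply: ler_sum => j _.
rewrite -subr_ge0; set p := x 0 j; set q := y 0 j.
rewrite [leRHS](_ : _ = a * (p - q / (2 * a)) ^+ 2); last by field; lra.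
by rewrite mulr_ge0 ?sqr_ge0// ltW.
Qed.

Lemma sqnormD2 x y : sqnorm (x + y) <= 2 * (sqnorm x + sqnorm y).
Proof.
rewrite /sqnorm -big_split/= mulr_sumr; apply: ler_sum => j _; rewrite mxE.
by have := sqr_ge0 (x 0 j - y 0 j); nra.
Qed.

Lemma sqnormD3 x y z : sqnorm (x + y + z) <= 3 * (sqnorm x + sqnorm y + sqnorm z).
Proof.
rewrite /sqnorm -!big_split/= mulr_sumr; apply: ler_sum => j _; rewrite !mxE.
have := sqr_ge0 (x 0 j - y 0 j); have := sqr_ge0 (x 0 j - z 0 j).
by have := sqr_ge0 (y 0 j - z 0 j); nra.
Qed.

Lemma sqr_sum_le I (r : seq I) (p : pred I) (f : I -> R) :
  (\sum_(i <- r | p i) f i) ^+ 2 <= (count p r)%:R * \sum_(i <- r | p i) f i ^+ 2.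
Proof.
elim: r => [|i r IH]; first by rewrite !big_nil expr0n mulr0.
rewrite !big_cons /=; case: ifPn => // _; rewrite natrD (_ : true%:R = 1 :> R)//.
set s := \sum_(_ <- _ | _) _ in IH *; set q := \sum_(_ <- _ | _) _ in IH *.
set k := (count p r)%:R in IH *.
have k0 : 0 <= k by exact: ler0n.
have q0 : 0 <= q by apply: sumr_ge0 => *; exact: sqr_ge0.
have [k1|k1] := eqVneq k 0.
  have : s ^+ 2 <= 0 by rewrite (le_trans IH)// k1 mul0r.
  by rewrite exprn_even_le0//= => /eqP ->; rewrite k1; nra.
have {k1}k0 : 0 < k by rewrite lt_def k1.
(* The cross term of [(f i + s)^2] is split with weight [k], so that the induction hypothesis turns
   [s^2 / k] into [q]; hence the separate case [k = 0]. *)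
have : 2 * f i * s <= k * f i ^+ 2 + s ^+ 2 / k.
  rewrite -subr_ge0 [leRHS](_ : _ = k * (f i - s / k) ^+ 2); last by field; rewrite gt_eqF.
  by rewrite mulr_ge0 ?sqr_ge0// ltW.
have : s ^+ 2 / k <= q by rewrite ler_pdivrMr// mulrC.
by nra.
Qed.

Lemma sqnorm_sum_le I (r : seq I) (p : pred I) (f : I -> 'rV[R]_d) :
  sqnorm (\sum_(i <- r | p i) f i) <=
  (count p r)%:R * \sum_(i <- r | p i) sqnorm (f i).
Proof.
rewrite /sqnorm exchange_big/= mulr_sumr; apply: ler_sum => j _.
by rewrite summxE; exact: sqr_sum_le.
Qed.

End vectors.

Lemma enorm_le_sqnorm {R : realType} {d e : nat} (x : 'rV[R]_d) (y : 'rV[R]_e) (L : R) :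
  enorm x <= L * enorm y -> sqnorm x <= L ^+ 2 * sqnorm y.
Proof.
rewrite /enorm => H.
rewrite -(@sqr_sqrtr _ (sqnorm x)) ?sqnorm_ge0//.
rewrite -(@sqr_sqrtr _ (sqnorm y)) ?sqnorm_ge0// -exprMn.
by rewrite ler_sqr// ?nnegrE ?sqrtr_ge0// (le_trans _ H)// sqrtr_ge0.
Qed.

Section descent.
Context {R : realType} {d : nat}.
Variables (f : 'rV[R]_d -> R) (g : 'rV[R]_d -> 'rV[R]_d) (L : R).
Hypothesis L0 : 0 < L.
Hypothesis fg : forall x h, is_derive x h f (dotv (g x) h).
Hypothesis gL : forall x y, sqnorm (g x - g y) <= L ^+ 2 * sqnorm (x - y).

(** Only directional derivatives are given, so there is no chain rule to invoke: the difference
    quotient of the restriction to the line is literally that of [f] in direction [h]. *)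
Lemma is_derive_line (x h : 'rV[R]_d) (s : R) :
  is_derive s 1 (fun t : R => f (x + t *: h)) (dotv (g (x + s *: h)) h).
Proof.
have [df dfE] := fg (x + s *: h) h.
have E : (fun t : R => t^-1 *: (f (x + (t *: (1 : R) + s) *: h) - f (x + s *: h))) =
         (fun t : R => t^-1 *: (f (t *: h + (x + s *: h)) - f (x + s *: h))).
  apply/funext => t; congr (_ *: (f _ - _)).
  by rewrite scalerDl addrCA -[t *: (1 : R)]/(t * 1) mulr1.
split.
- by rewrite /derivable /= E.
- by rewrite /derive /= E.
Qed.

(** The mean value theorem replaces integration along the segment. Subtracting [t a + t^2 b] from
    [f (x + t h)] makes the claim [phi 1 <= phi 0], and the derivative at the intermediate point [c]
    is nonpositive by the Lipschitz bound. *)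
Lemma descent (x h : 'rV[R]_d) : f (x + h) <= f x + dotv (g x) h + L / 2 * sqnorm h.
Proof.
pose a := dotv (g x) h; pose b := L / 2 * sqnorm h.
pose phi (t : R) := f (x + t *: h) - (t * a + t ^+ 2 * b).
have dphi (s : R) : is_derive s 1 phi (dotv (g (x + s *: h)) h - (a + 2 * s * b)).
  have := is_derive_line x h s => H.
  have H1 : is_derive s 1 (fun t : R => t * a + t ^+ 2 * b) (a + 2 * s * b).
    apply: is_derive_eq; rewrite /GRing.scale/=; ring.
  exact: is_deriveB.
have [|c] := @MVT R phi (fun s => dotv (g (x + s *: h)) h - (a + 2 * s * b)) 0 1
  ltr01 (fun s _ => dphi s).
  apply/continuous_subspaceT => s; apply: differentiable_continuous.
  by apply/derivable1_diffP; have [] := dphi s.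
rewrite in_itv/= => /andP[c0 c1]; rewrite /phi scale1r scale0r addr0 subr0 mulr1.
rewrite expr0n/= !mul0r addr0 subr0 expr1n !mul1r.
suff : dotv (g (x + c *: h)) h - a <= c * L * sqnorm h.
  by rewrite -/a /b; lra.
rewrite /a -dotvBl.
(* This weight makes both Young terms equal to [c L / 2 * |h|^2]. *)
rewrite (le_trans (@dotv_young _ _ _ _ (2 * c * L)^-1 _)) ?invr_gt0 ?mulr_gt0//.
have := gL (x + c *: h) x; rewrite [x + _ - x]addrAC subrr add0r sqnormZ => gc.
have -> : (4 * (2 * c * L)^-1)^-1 = c * L / 2 :> R by field; rewrite !gt_eqF.
rewrite [leRHS](_ : _ = (2 * c * L)^-1 * (L ^+ 2 * (c ^+ 2 * sqnorm h)) +
  c * L / 2 * sqnorm h); last by field; rewrite !gt_eqF.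
by rewrite lerD2r ler_wpM2l// invr_ge0 !mulr_ge0// ltW.
Qed.

End descent.

(** * A loss as a limit of Riemann sums of its gradient *)

Section riemann.
Context {R : realType} {d : nat}.
Variables (f : 'rV[R]_d -> R) (g : 'rV[R]_d -> 'rV[R]_d) (L : R).
Hypothesis L0 : 0 < L.
Hypothesis fg : forall x h, is_derive x h f (dotv (g x) h).
Hypothesis gL : forall x y, sqnorm (g x - g y) <= L ^+ 2 * sqnorm (x - y).

Lemma taylor1_bound (x h : 'rV[R]_d) :
  `|f (x + h) - f x - dotv (g x) h| <= L * sqnorm h.
Proof.
rewrite ler_norml; apply/andP; split; last first.
  have := descent L0 fg gL x h; have : 0 <= L * sqnorm h by rewrite mulr_ge0 ?sqnorm_ge0 ?ltW.
  by lra.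
have fg' y h' : is_derive y h' (\- f) (dotv (- g y) h').
  by rewrite dotvNl; exact: is_deriveN.
have gL' y y' : sqnorm (- g y - - g y') <= L ^+ 2 * sqnorm (y - y').
  by rewrite -opprD sqnormN.
have := descent L0 fg' gL' x h; rewrite dotvNl /=.
have : 0 <= L * sqnorm h by rewrite mulr_ge0 ?sqnorm_ge0 ?ltW.
by lra.
Qed.

(** [f x - f 0] telescopes along the segment from [0] to [x]. Each of the [N + 1] increments differs
    from its linear part by at most [L |x|^2 / (N + 1)^2], so the total error is [O(1/N)]. *)
Lemma riemann_sum_cvg (x : 'rV[R]_d) :
  (fun N => f 0 + \sum_(l < N.+1)
     dotv (g ((l%:R / N.+1%:R) *: x)) (N.+1%:R^-1 *: x)) @ \oo --> f x.
Proof.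
have E N : `|f x - (f 0 + \sum_(l < N.+1)
    dotv (g ((l%:R / N.+1%:R) *: x)) (N.+1%:R^-1 *: x))| <= L * sqnorm x / N.+1%:R.
  set M : R := N.+1%:R; have M0 : 0 < M by rewrite ltr0n.
  have -> : f x = f 0 + \sum_(l < N.+1) (f ((l.+1%:R / M) *: x) - f ((l%:R / M) *: x)).
    rewrite -(big_mkord xpredT (fun l => f ((l.+1%:R / M) *: x) - f ((l%:R / M) *: x))).
    rewrite (telescope_sumr (fun l => f ((l%:R / M) *: x)))//.
    by rewrite mul0r scale0r divff ?gt_eqF// scale1r addrC subrK.
  rewrite opprD addrACA subrr add0r -sumrB.
  rewrite (le_trans (ler_norm_sum _ _ _))//.
  rewrite (@le_trans _ _ (\sum_(l < N.+1) L * sqnorm (M^-1 *: x)))//.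
    apply: ler_sum => l _.
    rewrite (_ : (l.+1%:R / M) *: x = (l%:R / M) *: x + M^-1 *: x); last first.
      by rewrite -scalerDl -natr1 mulrDl mul1r.
    exact: taylor1_bound.
  rewrite sumr_const card_ord sqnormZ -mulr_natr -/M.
  by rewrite [leLHS](_ : _ = L * sqnorm x / M)//; field; rewrite gt_eqF.
apply/cvgrPdist_le => e e0.
have L' : 0 <= L * sqnorm x by rewrite mulr_ge0 ?sqnorm_ge0 ?ltW.
near=> N; apply: (le_trans (E N)).
rewrite ler_pdivrMr ?ltr0n// [e * _]mulrC -ler_pdivrMr//.
apply: (@le_trans _ _ N%:R); last by rewrite ler_nat.
by near: N; exact: nbhs_infty_ger.
Unshelve. all: by end_near.
Qed.

End riemann.

(** * Sampling without replacement *)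

Section sampling.
Context {R : realType} (n m : nat).
Hypotheses (n2 : (2 <= n)%N) (m1 : (1 <= m)%N) (mn : (m <= n)%N).
Implicit Type f : {set 'I_n} -> R.

Definition subset_avg f : R := ('C(n, m)%:R)^-1 * \sum_(S : {set 'I_n} | #|S| == m) f S.

Lemma subset_avgD f (g : {set 'I_n} -> R) : subset_avg (fun S => f S + g S) = subset_avg f + subset_avg g.
Proof. by rewrite /subset_avg big_split/= mulrDr. Qed.

Lemma subset_avgZ a f : subset_avg (fun S => a * f S) = a * subset_avg f.
Proof. by rewrite /subset_avg -mulr_sumr; ring. Qed.

Lemma subset_avg_sum I (r : seq I) (p : pred I) (f : I -> {set 'I_n} -> R) :
  subset_avg (fun S => \sum_(i <- r | p i) f i S) = \sum_(i <- r | p i) subset_avg (f i).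
Proof. by rewrite /subset_avg exchange_big/= mulr_sumr. Qed.

Lemma subset_avg_le f (g : {set 'I_n} -> R) : (forall S : {set 'I_n}, #|S| = m -> f S <= g S) ->
  subset_avg f <= subset_avg g.
Proof.
move=> fg; rewrite ler_wpM2l ?invr_ge0 ?ler0n//.
by apply: ler_sum => S /eqP; exact: fg.
Qed.

Lemma eq_subset_avg f (g : {set 'I_n} -> R) : (forall S : {set 'I_n}, #|S| = m -> f S = g S) ->
  subset_avg f = subset_avg g.
Proof. by move=> fg; congr (_ * _); apply: eq_bigr => S /eqP; exact: fg. Qed.

Let bin0 : 'C(n, m)%:R != 0 :> R.
Proof. by rewrite pnatr_eq0 -lt0n bin_gt0. Qed.

Lemma subset_avg_cst a : subset_avg (fun=> a) = a.
Proof.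
rewrite /subset_avg sumr_const -[X in a *+ X](_ : 'C(n, m) = _).
  by rewrite -[a *+ _]mulr_natr mulrCA mulVf ?mulr1.
rewrite -[in LHS](card_ord n) -card_draws.
by apply: eq_card => S; rewrite !inE.
Qed.

(** Sampling probabilities are reached through avoidance: the [m]-subsets avoiding [B] are the
    [m]-subsets of its complement, a plain binomial count. Singletons and pairs [B] give the two
    moments needed. *)
Lemma subset_avg_avoid (B : {set 'I_n}) :
  subset_avg (fun S => (S \subset ~: B)%:R) = 'C(n - #|B|, m)%:R / 'C(n, m)%:R.
Proof.
rewrite /subset_avg mulrC; congr (_ / _).
rewrite -[X in (X - _)%N](card_ord n) -[X in (_ - X)%N]/(#|B|) (_ : (_ - _)%N = #|~: B|); last first.
  by rewrite [RHS]cardsCs finset.setCK.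
rewrite -cards_draws -sum1_card natr_sum.
rewrite [LHS]big_mkcond [RHS]big_mkcond; apply: eq_bigr => S _.
by rewrite inE; case: eqP => _; rewrite ?andbF ?andbT//; case: ifP.
Qed.

Let n0 : n%:R != 0 :> R.
Proof. by rewrite pnatr_eq0 -lt0n (leq_trans _ n2). Qed.

Let n1 : n%:R - 1 != 0 :> R.
Proof. by rewrite -(natrB _ (ltnW n2)) pnatr_eq0 -lt0n subn_gt0. Qed.

Let mN0 : m%:R != 0 :> R.
Proof. by rewrite pnatr_eq0 -lt0n. Qed.

Lemma subset_avg_notin i : subset_avg (fun S => (i \notin S)%:R) = 1 - m%:R / n%:R.
Proof.
rewrite (eq_subset_avg (g := fun S => (S \subset ~: [set i]%SET)%:R)); last first.
  by move=> S _; rewrite finset.subsetC finset.sub1set finset.inE.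
rewrite subset_avg_avoid cards1 subn1.
have := mul_bin_down n m => /(congr1 (fun k => k%:R : R)).
rewrite !natrM natrB// => H; apply: (mulfI n0); rewrite mulrA H; field.
by rewrite n0 bin0.
Qed.

Lemma subset_avg_notin2 i j : i != j ->
  subset_avg (fun S => (i \notin S)%:R * (j \notin S)%:R) =
  (1 - m%:R / n%:R) * ((n%:R - m%:R - 1) / (n%:R - 1)).
Proof.
move=> ij; rewrite (eq_subset_avg (g := fun S => (S \subset ~: [set i; j]%SET)%:R)); last first.
  move=> S _; rewrite finset.subsetC.
  by rewrite finset.subUset !finset.sub1set !finset.inE -natrM mulnb.
rewrite subset_avg_avoid cards2 ij -addn1 subnDA subn1 subn1.
have H1 : n%:R * 'C(n.-1, m)%:R = (n%:R - m%:R) * 'C(n, m)%:R :> R.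
  by rewrite -natrB// -!natrM mul_bin_down.
have H2 : (n%:R - 1) * 'C(n.-1.-1, m)%:R = (n%:R - m%:R - 1) * 'C(n.-1, m)%:R :> R.
  (* For [m = n] the real factor [n - m - 1] is [-1] and is not the cast of a natural subtraction;
     both binomials vanish then. *)
  have [mn'|nm] := ltnP m n.
    rewrite -(natrB _ (ltnW n2)) -(natrB _ mn) -(@natrB _ (n - m)%N 1) ?subn_gt0//.
    by rewrite -!natrM subnAC subn1 mul_bin_down.
  by rewrite !bin_small ?mulr0//; lia.
have -> : 'C(n.-1.-1, m)%:R = (n%:R - m%:R - 1) * 'C(n.-1, m)%:R / (n%:R - 1) :> R.
  by rewrite -H2 mulrC mulKf.
have -> : 'C(n.-1, m)%:R = (n%:R - m%:R) * 'C(n, m)%:R / n%:R :> R.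
  by rewrite -H1 mulrC mulKf.
by field; rewrite n0 n1 bin0.
Qed.

Lemma subset_avg_suml (x : 'I_n -> R) :
  subset_avg (fun S => \sum_(i in S) x i) = m%:R / n%:R * \sum_i x i.
Proof.
rewrite (eq_subset_avg (g := fun S => \sum_i (x i + - x i * (i \notin S)%:R))); last first.
  move=> S _; rewrite big_mkcond; apply: eq_bigr => i _.
  by case: (i \in S); rewrite /= ?mulr0 ?addr0// mulr1 subrr.
rewrite subset_avg_sum mulr_sumr; apply: eq_bigr => i _.
by rewrite subset_avgD subset_avg_cst subset_avgZ subset_avg_notin; field.
Qed.

(** As the [y i] sum to zero, the sum over [S] is minus the sum over its complement, so the law of
    non-membership suffices. For fixed [i] the pair probabilities do not depend on [j], and the
    remaining [y j] sum to [- y i], which reduces the cross terms to squares. *)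
Lemma subset_avg_sqr (y : 'I_n -> R) : \sum_i y i = 0 ->
  subset_avg (fun S => (\sum_(i in S) y i) ^+ 2) =
  m%:R * (n%:R - m%:R) / (n%:R * (n%:R - 1)) * \sum_i y i ^+ 2.
Proof.
move=> y0; rewrite (eq_subset_avg (g := fun S => \sum_i \sum_j
    (y i * y j) * ((i \notin S)%:R * (j \notin S)%:R))); last first.
  move=> S _; have -> : \sum_(i in S) y i = - \sum_i y i * (i \notin S)%:R.
    apply/eqP; rewrite -addr_eq0; apply/eqP; rewrite -[RHS]y0 big_mkcond -big_split.
    by apply: eq_bigr => i _; case: (i \in S); rewrite /= ?mulr0 ?addr0// mulr1 add0r.
  rewrite sqrrN expr2 mulr_suml; apply: eq_bigr => i _; rewrite mulr_sumr.
  by apply: eq_bigr => j _; ring.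
rewrite subset_avg_sum mulr_sumr; apply: eq_bigr => i _; rewrite subset_avg_sum.
rewrite (bigD1 i)//= subset_avgZ.
rewrite (eq_subset_avg (g := fun S => (i \notin S)%:R)); last first.
  by move=> S _; rewrite -natrM mulnb andbb.
rewrite subset_avg_notin.
under eq_bigr => j ji do rewrite subset_avgZ subset_avg_notin2 1?eq_sym//.
rewrite -mulr_suml -mulr_sumr.
have -> : \sum_(j < n | j != i) y j = - y i.
  by apply/eqP; rewrite -addr_eq0 addrC; move: y0; rewrite (bigD1 i)//= => /eqP.
by field; rewrite n0 n1.
Qed.

Lemma subset_avg_sqnorm_mean (d : nat) (x : 'I_n -> 'rV[R]_d) :
  let xm := n%:R^-1 *: \sum_i x i in
  subset_avg (fun S => sqnorm (m%:R^-1 *: \sum_(i in S) x i)) =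
  sqnorm xm + (n%:R - m%:R) / (m%:R * (n%:R - 1)) *
    (n%:R^-1 * \sum_i sqnorm (x i - xm)).
Proof.
move=> xm; rewrite /sqnorm subset_avg_sum [X in _^-1 * X]exchange_big/= !mulr_sumr.
rewrite -big_split/=; apply: eq_bigr => j _.
pose y i := x i 0 j - xm 0 j.
have y0 : \sum_i y i = 0.
  rewrite sumrB sumr_const card_ord /xm mxE summxE -[X in _ - X]mulr_natr.
  by rewrite mulrAC mulVf// mul1r subrr.
rewrite (eq_subset_avg (g := fun S => (xm 0 j) ^+ 2 +
   (2 * xm 0 j / m%:R * (\sum_(i in S) y i) + (m%:R^-1) ^+ 2 * (\sum_(i in S) y i) ^+ 2))); last first.
  move=> S Sm; rewrite mxE summxE.
  have -> : \sum_(i in S) x i 0 j = m%:R * xm 0 j + \sum_(i in S) y i.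
    by rewrite sumrB sumr_const Sm -[X in _ + (_ - X)]mulr_natl [RHS]addrC subrK.
  by field.
rewrite !subset_avgD subset_avg_cst !subset_avgZ subset_avg_suml y0 subset_avg_sqr//.
under [in RHS]eq_bigr do rewrite !mxE -/xm.
rewrite (_ : \sum_i (_ - _) ^+ 2 = \sum_i y i ^+ 2); last first.
  by apply: eq_bigr => i _; rewrite /y /xm !mxE.
by field; rewrite n0 n1 mN0.
Qed.

(** The two upper bounds serve different terms of (A3): [k <= 1] is enough for the [rho] part, while
    the [delta] part must keep the factor [1 - m/n]. The constant [2] bounds [n / (n - 1)]. *)
Lemma sampling_factor_bounds (k : R) :
  k = (n%:R - m%:R) / (m%:R * (n%:R - 1)) ->
  [/\ 0 <= k, k <= 1 & k <= 2 * (1 - m%:R / n%:R)].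
Proof.
have m1' : 1 <= m%:R :> R by rewrite ler1n.
have mn' : m%:R <= n%:R :> R by rewrite ler_nat.
have n2' : 2 <= n%:R :> R by rewrite ler_nat.
have D0 : 0 < m%:R * (n%:R - 1) :> R by rewrite mulr_gt0//; lra.
move=> ->; split.
- by rewrite divr_ge0 ?subr_ge0// ltW.
- rewrite ler_pdivrMr//.
  have : 0 <= (m%:R - 1) * n%:R :> R by rewrite mulr_ge0//; lra.
  lra.
- rewrite ler_pdivrMr//.
  rewrite [leRHS](_ : _ = (n%:R - m%:R) * (2 * m%:R * (n%:R - 1) / n%:R)); last by field.
  rewrite ler_peMr ?subr_ge0// ler_pdivlMr ?mul1r; last lra.
  have : 0 <= (m%:R - 1) * (n%:R - 1) :> R by rewrite mulr_ge0//; lra.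
  lra.
Qed.

End sampling.

(** * One round for fixed samples *)

(** The trajectory always moves by [Gu] and [Gv], while the measured pair [G], [g] is free; one
    definition thus serves the noise of both blocks. *)
Definition local_noise {R : realType} {Z : Type} {d e c : nat}
  (Gu : 'rV[R]_d -> 'rV[R]_e -> Z -> 'rV[R]_d)
  (Gv : 'rV[R]_d -> 'rV[R]_e -> Z -> 'rV[R]_e)
  (G : 'rV[R]_d -> 'rV[R]_e -> Z -> 'rV[R]_c) (g : 'rV[R]_d -> 'rV[R]_e -> 'rV[R]_c)
  (gamu gamv : R) (zs : nat -> Z) (uv : 'rV[R]_d * 'rV[R]_e) (k : nat) : 'rV[R]_c :=
  let p := local_iter Gu Gv gamu gamv zs uv k in G p.1 p.2 (zs k) - g p.1 p.2.

(** Displacement of one block after [k] steps, with each stochastic gradient split into initial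
    gradient, drift and noise. Squaring produces a factor [k] in front of a sum extended to [tau]
    terms, and [k / tau <= 1 - 1/tau] is the source of the factor that kills drift at [tau = 1]. *)
Lemma drift_block {R : realType} {d : nat} (eta L : R) (tau k : nat)
    (g : 'rV[R]_d) (D xi : nat -> 'rV[R]_d) :
  0 < L -> (1 <= tau)%N -> (k < tau)%N ->
  L * sqnorm ((eta / (L * tau%:R)) *:
         (k%:R *: g + \sum_(l < k) D l + \sum_(l < k) xi l)) <=
  3 * eta ^+ 2 * (1 - tau%:R^-1) / tau%:R *
    (tau%:R * (sqnorm g / L) + (\sum_(l < tau) sqnorm (D l)) / L +
     (\sum_(l < tau) sqnorm (xi l)) / L).
Proof.
move=> L0 tau1 ktau.
have t0 : 0 < tau%:R :> R by rewrite ltr0n.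
have sub (f : nat -> 'rV[R]_d) : sqnorm (\sum_(l < k) f l) <=
    k%:R * \sum_(l < tau) sqnorm (f l).
  rewrite (le_trans (sqnorm_sum_le _ _ _))//.
  rewrite [X in X%:R * _](_ : _ = k); last first.
    by rewrite -sum1_count sum1_card cardT size_enum_ord.
  rewrite ler_wpM2l//.
  rewrite -!(big_mkord xpredT (fun l => sqnorm (f l))) (big_cat_nat (leq0n k) (ltnW ktau))/=.
  by rewrite lerDl sumr_ge0// => l _; exact: sqnorm_ge0.
rewrite sqnormZ.
apply: (@le_trans _ _ (L * ((eta / (L * tau%:R)) ^+ 2 * (3 * (k%:R * (tau%:R * sqnorm g +
    \sum_(l < tau) sqnorm (D l) + \sum_(l < tau) sqnorm (xi l))))))).
  rewrite ler_pM2l// ler_wpM2l ?sqr_ge0//.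
  rewrite (le_trans (sqnormD3 _ _ _))// ler_pM2l// !mulrDr !lerD//.
  rewrite sqnormZ expr2 -mulrA ler_wpM2l// ler_wpM2r ?sqnorm_ge0//.
  by rewrite ler_nat ltnW.
set X := (_ + _ + _ in leLHS).
have X0 : 0 <= X.
  rewrite !addr_ge0 ?mulr_ge0 ?sqnorm_ge0// sumr_ge0// => l _; exact: sqnorm_ge0.
rewrite [leLHS](_ : _ = 3 * eta ^+ 2 / tau%:R * (X / L) * (k%:R / tau%:R)); last first.
  by field; rewrite !gt_eqF.
rewrite [leRHS](_ : _ = 3 * eta ^+ 2 / tau%:R * (X / L) * (1 - tau%:R^-1)); last first.
  by rewrite /X; field; rewrite !gt_eqF.
rewrite ler_wpM2l//.
  have e2 : 0 <= 3 * eta ^+ 2 by rewrite pmulr_rge0// sqr_ge0.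
  by apply: mulr_ge0; apply: divr_ge0 => //; exact: ltW.
rewrite ler_pdivrMr// mulrBl mul1r mulVf ?gt_eqF//.
by rewrite lerBrDr natr1 ler_nat.
Qed.

(** * Client drift of one device *)

Section local_drift.
Context {R : realType} {Z : Type} {d e : nat}.
Variables (Gu : 'rV[R]_d -> 'rV[R]_e -> Z -> 'rV[R]_d)
          (Gv : 'rV[R]_d -> 'rV[R]_e -> Z -> 'rV[R]_e)
          (gu : 'rV[R]_d -> 'rV[R]_e -> 'rV[R]_d)
          (gv : 'rV[R]_d -> 'rV[R]_e -> 'rV[R]_e).
Variables (K Lu Lv eta : R) (tau : nat).
Hypotheses (Lu0 : 0 < Lu) (Lv0 : 0 < Lv) (K1 : 1 <= K) (eta0 : 0 < eta).
Hypotheses (etaK : 12 * K * eta <= 1) (tau1 : (1 <= tau)%N).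
Hypothesis gu_lip : forall u u' v v', sqnorm (gu u' v' - gu u v) <=
  2 * K * Lu * (Lu * sqnorm (u' - u) + Lv * sqnorm (v' - v)).
Hypothesis gv_lip : forall u u' v v', sqnorm (gv u' v' - gv u v) <=
  2 * K * Lv * (Lu * sqnorm (u' - u) + Lv * sqnorm (v' - v)).
Variables (zs : nat -> Z) (u : 'rV[R]_d) (v : 'rV[R]_e).

Let gamu := eta / (Lu * tau%:R).
Let gamv := eta / (Lv * tau%:R).
Let p := local_iter Gu Gv gamu gamv zs (u, v).
Let Du k := gu (p k).1 (p k).2 - gu u v.
Let Dv k := gv (p k).1 (p k).2 - gv u v.
Let xiu := local_noise Gu Gv Gu gu gamu gamv zs (u, v).
Let xiv := local_noise Gu Gv Gv gv gamu gamv zs (u, v).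
(** The one quantity that bounds the gradient changes [Du] and [Dv] of both blocks at once. *)
Let dev k := Lu * sqnorm ((p k).1 - u) + Lv * sqnorm ((p k).2 - v).
Let theta : R := 1 - tau%:R^-1.

Let iterE k :
  p k = (u - gamu *: (k%:R *: gu u v + \sum_(l < k) Du l + \sum_(l < k) xiu l),
         v - gamv *: (k%:R *: gv u v + \sum_(l < k) Dv l + \sum_(l < k) xiv l)).
Proof.
elim: k => [|k IH].
  by rewrite !big_ord0 !scale0r !addr0 !scaler0 !subr0.
have step : p k.+1 = ((p k).1 - gamu *: (gu u v + Du k + xiu k),
                      (p k).2 - gamv *: (gv u v + Dv k + xiv k)).
  rewrite /Du /Dv /xiu /xiv /local_noise [p k.+1]/=.
  by congr (_, _); apply/rowP => j; rewrite !mxE; ring.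
rewrite step IH /= !big_ord_recr/= -natr1 !scalerDl !scale1r.
by congr (_, _); apply/rowP => j; rewrite !mxE; ring.
Qed.

Let K0 : 0 <= K. Proof. exact: le_trans K1. Qed.

Let eta_ge0 : 0 <= eta. Proof. exact: ltW. Qed.

Let theta0 : 0 <= theta.
Proof. by rewrite subr_ge0 invf_le1 ?ler1n// ltr0n. Qed.

Let theta1 : theta <= 1.
Proof. by rewrite gerBl invr_ge0. Qed.

Let A := sqnorm (gu u v) / Lu + sqnorm (gv u v) / Lv.
Let Bu := tau%:R^-1 * \sum_(l < tau) sqnorm (xiu l).
Let Bv := tau%:R^-1 * \sum_(l < tau) sqnorm (xiv l).

Let t0 : 0 < tau%:R :> R. Proof. by rewrite ltr0n. Qed.

Let dev_ge0 k : 0 <= dev k.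
Proof. by rewrite addr_ge0// mulr_ge0 ?sqnorm_ge0 ?ltW. Qed.

(** The bound is self-referential rather than inductive in [k]: each [dev k] is controlled by the
    gradient changes, hence by the total [E] of all deviations. Since [12 K eta <= 1] and [K >= 1],
    [E] returns with coefficient at most [1/12]; moving it to the left turns the constant [3] into
    [36/11], rounded up to [4]. *)
Let mean_dev : tau%:R^-1 * \sum_(l < tau) dev l <=
  4 * eta ^+ 2 * theta * (A + Bu / Lu + Bv / Lv).
Proof.
set E := \sum_(l < tau) dev l.
have E0 : 0 <= E by apply: sumr_ge0.
have Dule : (\sum_(l < tau) sqnorm (Du l)) / Lu <= 2 * K * E.
  rewrite ler_pdivrMr// mulr_sumr mulr_suml; apply: ler_sum => l _.
  by rewrite (le_trans (gu_lip _ _ _ _))// /dev; lra.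
have Dvle : (\sum_(l < tau) sqnorm (Dv l)) / Lv <= 2 * K * E.
  rewrite ler_pdivrMr// mulr_sumr mulr_suml; apply: ler_sum => l _.
  by rewrite (le_trans (gv_lip _ _ _ _))// /dev; lra.
have devk (k : 'I_tau) : dev k <= 3 * eta ^+ 2 * theta / tau%:R *
    (tau%:R * A + 4 * K * E + tau%:R * (Bu / Lu + Bv / Lv)).
  rewrite /dev iterE /= [u - _ - _]addrAC subrr add0r [v - _ - _]addrAC subrr add0r !sqnormN.
  have := drift_block eta (gu u v) Du xiu Lu0 tau1 (ltn_ord k).
  have := drift_block eta (gv u v) Dv xiv Lv0 tau1 (ltn_ord k).
  move=> /lerD H /H {H} H; rewrite addrC (le_trans H)// -mulrDr -/theta.
  rewrite ler_wpM2l//.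
    by rewrite !mulr_ge0// ?sqr_ge0 ?invr_ge0// ltW.
  rewrite /A /Bu /Bv.
  rewrite (_ : tau%:R * (tau%:R^-1 * _ / Lu + tau%:R^-1 * _ / Lv) =
     (\sum_(l < tau) sqnorm (xiu l)) / Lu + (\sum_(l < tau) sqnorm (xiv l)) / Lv); last first.
    by field; rewrite !gt_eqF.
  by lra.
have EE : E <= 3 * eta ^+ 2 * theta *
    (tau%:R * A + 4 * K * E + tau%:R * (Bu / Lu + Bv / Lv)).
  rewrite (le_trans (ler_sum _ (fun k _ => devk k)))// sumr_const card_ord -[leLHS]mulr_natr.
  rewrite le_eqVlt; apply/orP; left; apply/eqP.
  by field; rewrite !gt_eqF.
have small : 12 * K * eta ^+ 2 * theta <= 1 / 12.
  have e12 : eta <= 1 / 12.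
    have : 0 <= (K - 1) * eta by rewrite mulr_ge0// subr_ge0.
    have := etaK; lra.
  have Ke : 12 * K * eta * eta <= eta by rewrite ler_piMl// ltW.
  have : 12 * K * eta ^+ 2 * theta <= 12 * K * eta ^+ 2.
    by rewrite ler_piMr// !mulr_ge0.
  by rewrite expr2; lra.
have {small}small : 3 * eta ^+ 2 * theta * (4 * K * E) <= 1 / 12 * E.
  by rewrite [leLHS](_ : _ = 12 * K * eta ^+ 2 * theta * E); [rewrite ler_wpM2r|ring].
rewrite mulrC ler_pdivrMr//.
set Y := tau%:R * A + tau%:R * (Bu / Lu + Bv / Lv).
have YE : (A + Bu / Lu + Bv / Lv) * tau%:R = Y by rewrite /Y; ring.
have Y0 : 0 <= Y.
  rewrite /Y /A !addr_ge0// mulr_ge0 ?addr_ge0 ?divr_ge0 ?sqnorm_ge0// ?(ltW Lu0) ?(ltW Lv0)//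
    mulr_ge0 ?invr_ge0// sumr_ge0// => l _; exact: sqnorm_ge0.
have EE' : E <= 3 * eta ^+ 2 * theta * Y + 3 * eta ^+ 2 * theta * (4 * K * E).
  by rewrite (le_trans EE)// /Y; lra.
have : 0 <= eta ^+ 2 * theta * Y by rewrite !mulr_ge0 ?sqr_ge0.
by move=> Y1; rewrite -[leRHS]mulrA YE; lra.
Qed.

(** Because [tau * gamu = eta / Lu], and likewise for [v], the whole local phase is one step of size
    [eta / L] along the initial gradient, perturbed by a remainder and the mean noise. The
    remainders are the mean gradient changes; the constant is [2 K] from smoothness times [4] from
    [mean_dev]. *)
Lemma local_update : exists ru rv,
  let W := 8 * K * eta ^+ 2 * theta * (A + Bu / Lu + Bv / Lv) in
  [/\ p tau = (u - (eta / Lu) *: (gu u v + ru + tau%:R^-1 *: \sum_(l < tau) xiu l),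
               v - (eta / Lv) *: (gv u v + rv + tau%:R^-1 *: \sum_(l < tau) xiv l)),
      sqnorm ru <= Lu * W & sqnorm rv <= Lv * W].
Proof.
exists (tau%:R^-1 *: \sum_(l < tau) Du l), (tau%:R^-1 *: \sum_(l < tau) Dv l) => W.
have mean_le (c : nat) (f : nat -> 'rV[R]_c) L : 0 < L ->
    (forall l, sqnorm (f l) <= 2 * K * L * dev l) ->
    sqnorm (tau%:R^-1 *: \sum_(l < tau) f l) <= L * W.
  move=> L0 fle; rewrite sqnormZ.
  apply: (@le_trans _ _ (tau%:R^-1 ^+ 2 * (tau%:R * \sum_(l < tau) 2 * K * L * dev l))).
    rewrite ler_wpM2l ?sqr_ge0// (le_trans (sqnorm_sum_le _ _ _))//.
    rewrite [X in X%:R * _](_ : _ = tau); last first.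
      by rewrite -sum1_count sum1_card cardT size_enum_ord.
    by rewrite ler_wpM2l//; apply: ler_sum.
  rewrite -mulr_sumr [leLHS](_ : _ = 2 * K * L * (tau%:R^-1 * \sum_(l < tau) dev l)); last first.
    by field; rewrite gt_eqF.
  have KL : 0 <= 2 * K * L by rewrite !mulr_ge0 ?(ltW L0).
  rewrite (le_trans (ler_wpM2l KL mean_dev))// /W.
  by rewrite le_eqVlt; apply/orP; left; apply/eqP; ring.
split; last 2 first.
- by apply: mean_le => // l; exact: gu_lip.
- by apply: mean_le => // l; exact: gv_lip.
rewrite iterE; congr (_ - _, _ - _); apply/rowP => j; rewrite !mxE /gamu /gamv;
  by field; rewrite !gt_eqF.
Qed.

Lemma mean_noise_le (c : nat) (xi : nat -> 'rV[R]_c) :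
  sqnorm (tau%:R^-1 *: \sum_(l < tau) xi l) <= tau%:R^-1 * \sum_(l < tau) sqnorm (xi l).
Proof.
rewrite sqnormZ expr2 -mulrA ler_wpM2l ?invr_ge0//.
rewrite ler_pdivrMl// (le_trans (sqnorm_sum_le _ _ _))//.
by rewrite -sum1_count sum1_card cardT size_enum_ord.
Qed.

End local_drift.

(** * Smoothness in both blocks at once *)

Section joint_smoothness.
Context {R : realType} {d e : nat}.
Variables (F : 'rV[R]_d -> 'rV[R]_e -> R)
          (gu : 'rV[R]_d -> 'rV[R]_e -> 'rV[R]_d)
          (gv : 'rV[R]_d -> 'rV[R]_e -> 'rV[R]_e).
Variables (Lu Lv Luv Lvu chi : R).
Hypotheses (Lu0 : 0 < Lu) (Lv0 : 0 < Lv).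
Hypothesis Fu : forall u v h, is_derive u h (fun x => F x v) (dotv (gu u v) h).
Hypothesis Fv : forall u v h, is_derive v h (fun y => F u y) (dotv (gv u v) h).
Hypothesis guu : forall u u' v, enorm (gu u v - gu u' v) <= Lu * enorm (u - u').
Hypothesis gvv : forall u v v', enorm (gv u v - gv u v') <= Lv * enorm (v - v').
Hypothesis guv : forall u v v', enorm (gu u v - gu u v') <= Luv * enorm (v - v').
Hypothesis gvu : forall u u' v, enorm (gv u v - gv u' v) <= Lvu * enorm (u - u').
Hypothesis cross : Num.max Luv Lvu <= chi * Num.sqrt (Lu * Lv).

Let guv_sq u v v' : sqnorm (gu u v - gu u v') <= chi ^+ 2 * (Lu * Lv) * sqnorm (v - v').
Proof.
rewrite -[Lu * Lv]sqr_sqrtr; last by rewrite ltW ?mulr_gt0.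
rewrite -exprMn; apply: enorm_le_sqnorm.
rewrite (le_trans (guv _ _ _))// ler_wpM2r ?sqrtr_ge0//.
by apply: le_trans cross; rewrite le_max lexx.
Qed.

Let gvu_sq u u' v : sqnorm (gv u v - gv u' v) <= chi ^+ 2 * (Lu * Lv) * sqnorm (u - u').
Proof.
rewrite -[Lu * Lv]sqr_sqrtr; last by rewrite ltW ?mulr_gt0.
rewrite -exprMn; apply: enorm_le_sqnorm.
rewrite (le_trans (gvu _ _ _))// ler_wpM2r ?sqrtr_ge0//.
by apply: le_trans cross; rewrite le_max lexx orbT.
Qed.

(** Pass through the mixed point [(u, v')]. The cross constant squared, [chi^2 Lu Lv], shares the
    factor [Lu] with [Lu^2], which leaves the weights [Lu], [Lv] of the common distance. *)
Lemma gradu_joint_lip u u' v v' : sqnorm (gu u' v' - gu u v) <=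
  2 * (1 + chi ^+ 2) * Lu * (Lu * sqnorm (u' - u) + Lv * sqnorm (v' - v)).
Proof.
rewrite -(subrK (gu u v') (gu u' v')) -addrA (le_trans (sqnormD2 _ _))//.
rewrite -!mulrA ler_pM2l//.
have H1 := enorm_le_sqnorm (guu u' u v'); have H2 := guv_sq u v' v.
have p1 : 0 <= chi ^+ 2 * (Lu ^+ 2 * sqnorm (u' - u)).
  by rewrite mulr_ge0 ?sqr_ge0// mulr_ge0 ?sqr_ge0 ?sqnorm_ge0.
have p2 : 0 <= Lu * Lv * sqnorm (v' - v).
  by rewrite mulr_ge0 ?sqnorm_ge0// ltW// mulr_gt0.
by lra.
Qed.

Lemma gradv_joint_lip u u' v v' : sqnorm (gv u' v' - gv u v) <=
  2 * (1 + chi ^+ 2) * Lv * (Lu * sqnorm (u' - u) + Lv * sqnorm (v' - v)).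
Proof.
rewrite -(subrK (gv u' v) (gv u' v')) -addrA (le_trans (sqnormD2 _ _))//.
rewrite -!mulrA ler_pM2l//.
have H1 := enorm_le_sqnorm (gvv u' v' v); have H2 := gvu_sq u' u v.
have p1 : 0 <= chi ^+ 2 * (Lv ^+ 2 * sqnorm (v' - v)).
  by rewrite mulr_ge0 ?sqr_ge0// mulr_ge0 ?sqr_ge0 ?sqnorm_ge0.
have p2 : 0 <= Lu * Lv * sqnorm (u' - u).
  by rewrite mulr_ge0 ?sqnorm_ge0// ltW// mulr_gt0.
by lra.
Qed.

(** Moving [v] first keeps its gradient at [(u, v)], so a single cross term remains: the
    [u]-gradient at [v + k] instead of [v]. Young with weight [1 / (2 Lu)] charges it to
    [Lu / 2 * |h|^2] and [chi^2 Lv / 2 * |k|^2]. *)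
Lemma joint_descent u v h k : F (u + h) (v + k) <= F u v + dotv (gu u v) h +
  dotv (gv u v) k + (1 + chi ^+ 2) * (Lu * sqnorm h + Lv * sqnorm k).
Proof.
have D1 := descent Lu0 (fun x h' => Fu x (v + k) h')
  (fun x y => enorm_le_sqnorm (guu x y (v + k))) u h.
have D2 := descent Lv0 (fun y k' => Fv u y k')
  (fun x y => enorm_le_sqnorm (gvv u x y)) v k.
have -> : dotv (gu u v) h = dotv (gu u (v + k)) h - dotv (gu u (v + k) - gu u v) h.
  by rewrite dotvBl; ring.
have L20 : 0 < (2 * Lu)^-1 by rewrite invr_gt0 mulr_gt0.
have Y := dotv_young (gu u (v + k) - gu u v) h L20.
have := guv_sq u (v + k) v; rewrite [v + k - v]addrAC subrr add0r => X.
have {}Y : dotv (gu u (v + k) - gu u v) h <=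
    chi ^+ 2 * Lv / 2 * sqnorm k + Lu / 2 * sqnorm h.
  rewrite (le_trans Y)//.
  have -> : (4 * (2 * Lu)^-1)^-1 = Lu / 2 by field; rewrite gt_eqF.
  rewrite lerD2r (le_trans (ler_wpM2l (ltW L20) X))// le_eqVlt; apply/orP; left.
  by apply/eqP; field; rewrite gt_eqF.
have p1 : 0 <= chi ^+ 2 * (Lu * sqnorm h).
  by rewrite mulr_ge0 ?sqr_ge0// mulr_ge0 ?sqnorm_ge0// ltW.
have p2 : 0 <= Lv * sqnorm k by rewrite mulr_ge0 ?sqnorm_ge0// ltW.
have p3 : 0 <= chi ^+ 2 * (Lv * sqnorm k) by rewrite mulr_ge0 ?sqr_ge0.
by lra.
Qed.

End joint_smoothness.

(* Here [x], [y], [D], [p], [q] are the two squared gradients, the diversity and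
   the two noise levels, each divided by its smoothness constant; [r] is [m / n]
   and [W] bounds the client drift. *)
Lemma round_scalar (R : realType) (K Q eta theta r x y D p q W : R) :
  1 <= K -> 1 <= Q -> 0 < eta -> 0 <= theta -> 0 <= r <= 1 ->
  12 * K * Q * eta <= 1 -> 196 * K * Q * eta ^+ 2 * theta <= r ->
  0 <= x -> 0 <= y -> 0 <= D -> 0 <= p -> 0 <= q -> 0 <= W ->
  W <= 8 * K * eta ^+ 2 * theta * (Q * x + D + y + p + q) ->
  - eta * (3 / 4 * x - W) + 3 * K * eta ^+ 2 * (Q * x + 2 * (1 - r) * D + W + p) +
  r * (eta * (- (3 / 4) * y + W) + 3 * K * eta ^+ 2 * (y + W + q)) <=
  - (eta / 4) * (x + r * y) + 6 * K * eta ^+ 2 * (1 - r) * D +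
  20 * K * eta ^+ 3 * theta * D + 3 * K * eta ^+ 2 * (p + r * q) +
  20 * K * eta ^+ 3 * theta * (p + q).
Proof.
move=> K1 Q1 eta0 th0 /andP[r0 r1] h1 h2 x0 y0 D0 p0 q0 W0 HW.
have K0 : 0 <= K by lra.
have Q0 : 0 <= Q by lra.
have e0 := ltW eta0.
(* The budget: each term [3 K eta^2] times [Q x], [y] or [W] costs at most [eta / 4] times [x], [y]
   or [W]. Hence [W] appears with at most [5/2 * eta], and [20 = 5/2 * 8]; by the second step-size
   condition its share of [x] and [y] is at most [20/196], so [-1/2] stays below [-1/4]. *)
have a1 : 12 * K * Q * eta * (eta * x) <= eta * x by rewrite ler_piMl// mulr_ge0.
have h1' : 12 * K * eta <= 1.
  have : 0 <= K * eta * (Q - 1) by rewrite !mulr_ge0// subr_ge0.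
  by lra.
have a2 : 12 * K * eta * (eta * (r * y)) <= eta * (r * y) by rewrite ler_piMl// !mulr_ge0.
have a3 : 12 * K * eta * (eta * W) <= eta * W by rewrite ler_piMl// !mulr_ge0.
have a4 : 12 * K * eta * (eta * W) * r <= eta * W * r by rewrite ler_wpM2r.
have a5 : eta * W * r <= eta * W by rewrite ler_piMr// mulr_ge0.
have a6 : eta * W <= eta * (8 * K * eta ^+ 2 * theta * (Q * x + D + y + p + q)).
  by rewrite ler_wpM2l.
have h3 : 196 * K * Q * eta ^+ 2 * theta <= 1 by lra.
have a7 : 196 * K * Q * eta ^+ 2 * theta * (eta * x) <= eta * x.
  by rewrite ler_piMl// mulr_ge0.
have a8 : 196 * K * Q * eta ^+ 2 * theta * (eta * y) <= r * (eta * y).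
  by rewrite ler_wpM2r// mulr_ge0.
have a9 : 0 <= K * eta ^+ 2 * theta * (eta * y) * (Q - 1).
  by rewrite !mulr_ge0// subr_ge0.
have b1 : 0 <= eta * x by rewrite mulr_ge0.
have b2 : 0 <= eta * (r * y) by rewrite !mulr_ge0.
by lra.
Qed.

Lemma sqnorm_mean_le (R : realType) (d n : nat) (x : 'I_n -> 'rV[R]_d) : (0 < n)%N ->
  sqnorm (n%:R^-1 *: \sum_i x i) <= n%:R^-1 * \sum_i sqnorm (x i).
Proof.
move=> n0; have n0' : 0 < n%:R :> R by rewrite ltr0n.
rewrite sqnormZ expr2 -mulrA ler_pM2l ?invr_gt0// ler_pdivrMl//.
rewrite (le_trans (sqnorm_sum_le _ _ _))//.
by rewrite -sum1_count sum1_card cardT size_enum_ord.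
Qed.

Lemma subset_avg_mean_le (R : realType) (d n m : nat) (x : 'I_n -> 'rV[R]_d) :
  (2 <= n)%N -> (1 <= m)%N -> (m <= n)%N ->
  subset_avg m (fun S => sqnorm (m%:R^-1 *: \sum_(i in S) x i)) <=
  n%:R^-1 * \sum_i sqnorm (x i).
Proof.
move=> n2 m1 mn; have m0 : 0 < m%:R :> R by rewrite ltr0n.
apply: (@le_trans _ _ (subset_avg m (fun S : {set 'I_n} =>
    m%:R^-1 * \sum_(i in S) sqnorm (x i)))).
  apply: subset_avg_le => S Sm.
  rewrite sqnormZ expr2 -mulrA ler_pM2l ?invr_gt0// ler_pdivrMl//.
  rewrite (le_trans (sqnorm_sum_le _ _ _))// -sum1_count.
  rewrite [X in X%:R * _](_ : _ = m)// -Sm -sum1_card.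
  exact: eq_bigl.
by rewrite subset_avgZ subset_avg_suml// mulrA mulrA mulVf ?gt_eqF// mul1r.
Qed.

Lemma sum_sqnorm_diversity (R : realType) (d n : nat) (x : 'I_n -> 'rV[R]_d) : (0 < n)%N ->
  let xm := n%:R^-1 *: \sum_i x i in
  n%:R^-1 * \sum_i sqnorm (x i) = sqnorm xm + n%:R^-1 * \sum_i sqnorm (x i - xm).
Proof.
move=> n0 xm; have n0' : n%:R != 0 :> R by rewrite pnatr_eq0 -lt0n.
have E i : sqnorm (x i - xm) = sqnorm (x i) - 2 * dotv xm (x i) + sqnorm xm.
  rewrite /sqnorm /dotv mulr_sumr -sumrB -big_split/=; apply: eq_bigr => j _.
  by rewrite !mxE; ring.
under [in RHS]eq_bigr do rewrite E.
rewrite big_split/= sumrB -mulr_sumr -dotv_sumr sumr_const card_ord.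
have -> : \sum_i x i = n%:R *: xm by rewrite /xm scalerA divff// scale1r.
rewrite dotvZr -sqnormE -[sqnorm xm *+ n]mulr_natl; field.
exact: n0'.
Qed.

(** * Descent over one round, averaged over the selected set *)

Section round.
Context {R : realType} {Z : Type} {n d : nat} {dv : 'I_n -> nat}.
Unset Implicit Arguments.
Variables (F : forall i : 'I_n, 'rV[R]_d -> 'rV[R]_(dv i) -> R)
          (gu : forall i : 'I_n, 'rV[R]_d -> 'rV[R]_(dv i) -> 'rV[R]_d)
          (gv : forall i : 'I_n, 'rV[R]_d -> 'rV[R]_(dv i) -> 'rV[R]_(dv i))
          (Gu : forall i : 'I_n, 'rV[R]_d -> 'rV[R]_(dv i) -> Z -> 'rV[R]_d)
          (Gv : forall i : 'I_n, 'rV[R]_d -> 'rV[R]_(dv i) -> Z -> 'rV[R]_(dv i)).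
Variables (m tau : nat) (K Q Lu Lv eta delta rho : R).
Hypotheses (n2 : (2 <= n)%N) (m1 : (1 <= m)%N) (mn : (m <= n)%N) (tau1 : (1 <= tau)%N).
Hypotheses (Lu0 : 0 < Lu) (Lv0 : 0 < Lv) (K1 : 1 <= K) (eta0 : 0 < eta).
Hypothesis QE : Q = 1 + rho ^+ 2.
Hypothesis F_descent : forall i u v h k, F i (u + h) (v + k) <= F i u v +
  dotv (gu i u v) h + dotv (gv i u v) k + K * (Lu * sqnorm h + Lv * sqnorm k).
Hypothesis gu_lip : forall i u u' v v', sqnorm (gu i u' v' - gu i u v) <=
  2 * K * Lu * (Lu * sqnorm (u' - u) + Lv * sqnorm (v' - v)).
Hypothesis gv_lip : forall i u u' v v', sqnorm (gv i u' v' - gv i u v) <=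
  2 * K * Lv * (Lu * sqnorm (u' - u) + Lv * sqnorm (v' - v)).
Hypothesis diversity : forall u V,
  n%:R^-1 * \sum_(i < n) sqnorm (gu i u (V i) - gradFu gu u V) <=
  delta ^+ 2 + rho ^+ 2 * sqnorm (gradFu gu u V).
Let theta : R := 1 - tau%:R^-1.
Hypothesis eta_small : 12 * K * Q * eta <= 1.
Hypothesis eta_small2 : 196 * K * Q * eta ^+ 2 * theta <= m%:R / n%:R.

Let gamu := eta / (Lu * tau%:R).
Let gamv := eta / (Lv * tau%:R).
Variables (zs : 'I_n -> nat -> Z) (s : fstate R n d dv).
Let xiu i := local_noise (Gu i) (Gv i) (Gu i) (gu i) gamu gamv (zs i) (s.1, s.2 i).
Let xiv i := local_noise (Gu i) (Gv i) (Gv i) (gv i) gamu gamv (zs i) (s.1, s.2 i).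
Let gbar := gradFu gu s.1 s.2.

Set Implicit Arguments.

(** The gradients here are those of the starting state, so for a fixed state this is a linear
    combination of noise coordinates with constant coefficients. The factor [m / n] is the
    probability that device [i] updates [v i]. *)
Definition noise_lin : R := n%:R^-1 * \sum_i (tau%:R^-1 * \sum_(k < tau)
  (- (eta / Lu) * dotv gbar (xiu i k) -
   m%:R / n%:R * (eta / Lv) * dotv (gv i s.1 (s.2 i)) (xiv i k))).

Definition noise_quad : R := n%:R^-1 * \sum_i (tau%:R^-1 * \sum_(k < tau)
  ((3 * K * eta ^+ 2 + 20 * K * eta ^+ 3 * theta) / Lu * sqnorm (xiu i k) +
   (3 * K * eta ^+ 2 * (m%:R / n%:R) + 20 * K * eta ^+ 3 * theta) / Lv *
     sqnorm (xiv i k))).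

(** The effective gradients [a i], [b i] of the local runs do not depend on [S]. After the descent
    bound, [S] enters only through sums over the selected devices and the squared norm of a sampled
    mean, whose averages are known. *)
Lemma round_avg :
  subset_avg m (fun S => let s' := fedsim_round Gu Gv m tau gamu gamv S zs s in
    Fobj F s'.1 s'.2) <=
  Fobj F s.1 s.2 - eta / 4 * (Delta_u gu s / Lu + m%:R / n%:R * (Delta_v gv s / Lv)) +
  (6 * K * eta ^+ 2 * (1 - m%:R / n%:R) * (delta ^+ 2 / Lu) +
   20 * K * eta ^+ 3 * theta * (delta ^+ 2 / Lu)) + noise_lin + noise_quad.
Proof.
have n0 : 0 < n%:R :> R by rewrite ltr0n (leq_trans _ n2).
have m0 : 0 < m%:R :> R by rewrite ltr0n.
have t0 : 0 < tau%:R :> R by rewrite ltr0n.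
have nN : (0 < n)%N by exact: leq_trans n2.
have Q1 : 1 <= Q by rewrite QE lerDl sqr_ge0.
have K0 : 0 <= K by exact: le_trans K1.
have e0 := ltW eta0.
have etaK : 12 * K * eta <= 1.
  have : 0 <= K * eta * (Q - 1) by rewrite !mulr_ge0// subr_ge0.
  by have := eta_small; lra.
pose Bu i := tau%:R^-1 * \sum_(l < tau) sqnorm (xiu i l).
pose Bv i := tau%:R^-1 * \sum_(l < tau) sqnorm (xiv i l).
pose g i := gu i s.1 (s.2 i).
pose h i := gv i s.1 (s.2 i).
pose W i := 8 * K * eta ^+ 2 * theta *
  (sqnorm (g i) / Lu + sqnorm (h i) / Lv + Bu i / Lu + Bv i / Lv).
pose Nu i := tau%:R^-1 *: \sum_(l < tau) xiu i l.
pose Nv i := tau%:R^-1 *: \sum_(l < tau) xiv i l.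
(* The remainders are chosen once for every device, before any [S] is considered. *)
have upd i := cid (local_update (Gu i) (Gv i) Lu0 Lv0 K1 eta0 etaK tau1
  (gu_lip i) (gv_lip i) (zs i) s.1 (s.2 i)).
pose ru i := sval (upd i).
pose rv i := sval (cid (svalP (upd i))).
have updE i : [/\ local_iter (Gu i) (Gv i) gamu gamv (zs i) (s.1, s.2 i) tau =
     (s.1 - (eta / Lu) *: (g i + ru i + Nu i), s.2 i - (eta / Lv) *: (h i + rv i + Nv i)),
     sqnorm (ru i) <= Lu * W i & sqnorm (rv i) <= Lv * W i].
  exact: (svalP (cid (svalP (upd i)))).
clearbody ru rv.
pose a i := g i + ru i + Nu i.
pose b i := h i + rv i + Nv i.
pose w i := - (eta / Lv) * dotv (h i) (b i) + K * (eta ^+ 2 / Lv) * sqnorm (b i).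
have gbarE : gbar = n%:R^-1 *: \sum_i g i by [].
have step (S : {set 'I_n}) : #|S| = m ->
    (let s' := fedsim_round Gu Gv m tau gamu gamv S zs s in Fobj F s'.1 s'.2) <=
    Fobj F s.1 s.2 + (- (eta / Lu) * m%:R^-1 * \sum_(i in S) dotv gbar (a i) +
     (K * (eta ^+ 2 / Lu) * sqnorm (m%:R^-1 *: \sum_(i in S) a i) +
      n%:R^-1 * \sum_(i in S) w i)).
  move=> Sm /=.
  pose hh := - (eta / Lu) *: (m%:R^-1 *: \sum_(i in S) a i).
  pose kk i := if i \in S then - (eta / Lv) *: b i else 0.
  have -> : m%:R^-1 *: (\sum_(i in S)
      (local_iter (Gu i) (Gv i) gamu gamv (zs i) (s.1, s.2 i) tau).1) = s.1 + hh.
    under eq_bigr => i _ do rewrite (let: And3 p _ _ := updE i in p) /=.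
    rewrite sumrB sumr_const Sm -[s.1 *+ m]scaler_nat -scaler_sumr scalerBr scalerA.
    rewrite [X in X *: s.1]mulVf ?gt_eqF// scale1r /hh scaleNr !scalerA.
    by rewrite [_ * (eta / Lu)]mulrC.
  rewrite /Fobj.
  apply: (@le_trans _ _ (n%:R^-1 * \sum_i (F i s.1 (s.2 i) + dotv (g i) hh +
      dotv (h i) (kk i) + K * (Lu * sqnorm hh + Lv * sqnorm (kk i))))).
    rewrite ler_pM2l ?invr_gt0//; apply: ler_sum => i _.
    rewrite (_ : (if i \in S then _ else _) = s.2 i + kk i); first exact: F_descent.
    rewrite /kk; case: ifP => _; last by rewrite addr0.
    by rewrite (let: And3 p _ _ := updE i in p) /= scaleNr.
  have -> : \sum_i (F i s.1 (s.2 i) + dotv (g i) hh + dotv (h i) (kk i) +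
        K * (Lu * sqnorm hh + Lv * sqnorm (kk i))) =
      \sum_i F i s.1 (s.2 i) + dotv (\sum_i g i) hh + \sum_i dotv (h i) (kk i) +
      K * (n%:R * (Lu * sqnorm hh) + Lv * \sum_i sqnorm (kk i)).
    rewrite !big_split/= -mulr_sumr big_split/= sumr_const card_ord.
    by rewrite dotv_suml mulr_natl [Lv * \sum_(i < n) _]mulr_sumr.
  have -> : \sum_i dotv (h i) (kk i) = \sum_(i in S) (- (eta / Lv) * dotv (h i) (b i)).
    rewrite [RHS]big_mkcond; apply: eq_bigr => i _; rewrite /kk.
    by case: ifP => _; rewrite ?dotv0r// dotvZr.
  have -> : \sum_i sqnorm (kk i) = \sum_(i in S) (eta / Lv) ^+ 2 * sqnorm (b i).
    rewrite [RHS]big_mkcond; apply: eq_bigr => i _; rewrite /kk.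
    by case: ifP => _; rewrite ?sqnorm0// sqnormZ sqrrN.
  have -> : \sum_i g i = n%:R *: gbar by rewrite gbarE scalerA divff ?gt_eqF// scale1r.
  rewrite /hh dotvZl !dotvZr dotv_sumr sqnormZ -!mulr_sumr.
  have -> : \sum_(i in S) w i = - (eta / Lv) * (\sum_(i in S) dotv (h i) (b i)) +
      K * (eta ^+ 2 / Lv) * \sum_(i in S) sqnorm (b i).
    by rewrite /w big_split/= -!mulr_sumr.
  rewrite le_eqVlt; apply/orP; left; apply/eqP.
  by field; rewrite !gt_eqF.
rewrite (le_trans (subset_avg_le step))//.
rewrite !subset_avgD subset_avg_cst// !subset_avgZ !subset_avg_suml//.
set SQ := subset_avg m _.
pose Wm := n%:R^-1 * \sum_i W i.
pose Pu := n%:R^-1 * \sum_i Bu i.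
pose Pv := n%:R^-1 * \sum_i Bv i.
pose lu := dotv gbar (n%:R^-1 *: \sum_i Nu i).
pose lv := n%:R^-1 * \sum_i dotv (h i) (Nv i).
pose gg := sqnorm gbar.
pose hh := n%:R^-1 * \sum_i sqnorm (h i).
have mean_ge0 (f : 'I_n -> R) : (forall i, 0 <= f i) -> 0 <= n%:R^-1 * \sum_i f i.
  by move=> f0; rewrite mulr_ge0 ?invr_ge0 ?(ltW n0)// sumr_ge0.
have mean_le (f f' : 'I_n -> R) : (forall i, f i <= f' i) ->
    n%:R^-1 * \sum_i f i <= n%:R^-1 * \sum_i f' i.
  by move=> ff; rewrite ler_pM2l ?invr_gt0// ler_sum.
have theta0 : 0 <= theta by rewrite subr_ge0 invf_le1 ?ler1n.
have Bu0 i : 0 <= Bu i.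
  by rewrite mulr_ge0 ?invr_ge0// sumr_ge0// => l _; exact: sqnorm_ge0.
have Bv0 i : 0 <= Bv i.
  by rewrite mulr_ge0 ?invr_ge0// sumr_ge0// => l _; exact: sqnorm_ge0.
have W0 i : 0 <= W i.
  by rewrite !mulr_ge0// !addr_ge0// divr_ge0 ?sqnorm_ge0// ltW.
have ruW : n%:R^-1 * \sum_i sqnorm (ru i) <= Lu * Wm.
  rewrite /Wm mulrCA [Lu * _]mulr_sumr; apply: mean_le => i.
  by have [] := updE i.
have NuB : n%:R^-1 * \sum_i sqnorm (Nu i) <= Pu.
  by apply: mean_le => i; exact: mean_noise_le.
have G2 : n%:R^-1 * \sum_i sqnorm (g i) <= Q * gg + delta ^+ 2.
  rewrite sum_sqnorm_diversity//= -gbarE -/gg.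
  by have := diversity s.1 s.2; rewrite -/gbar -/gg QE; lra.
have HW : Wm <= 8 * K * eta ^+ 2 * theta *
    (Q * (gg / Lu) + delta ^+ 2 / Lu + hh / Lv + Pu / Lu + Pv / Lv).
  rewrite /Wm /W -mulr_sumr mulrCA ler_wpM2l ?mulr_ge0//.
  rewrite !big_split/= -!mulr_suml !mulrDr !mulrA -/hh -/Pu -/Pv.
  by rewrite !lerD2r -mulrDl ler_pM2r ?invr_gt0.
(* Weight [1/4] gives up a quarter of [gg] and pays for the remainder with coefficient one; the
   noise inner product [lu] is left exact, to vanish in expectation. *)
have cross : - dotv gbar (n%:R^-1 *: \sum_i a i) <= - (3 / 4 * gg) + Lu * Wm - lu.
  rewrite /a !big_split/= !scalerDr !dotvDr -gbarE -sqnormE -/gg -/lu.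
  have := @dotv_young _ _ gbar (- (n%:R^-1 *: \sum_i ru i)) 4^-1.
  rewrite dotvNr sqnormN divff// invr1 mul1r invr_gt0 ltr0n => /(_ isT).
  have := le_trans (sqnorm_mean_le ru nN) ruW; rewrite -/gg.
  by lra.
(* The sum is split before averaging, so only the [g] part goes through the exact sampling variance,
   where [1 - m/n] multiplies the diversity. Remainder and noise need only convexity. *)
have SQle : SQ <= 3 * (Q * gg + 2 * (1 - m%:R / n%:R) * delta ^+ 2 + Lu * Wm + Pu).
  apply: (@le_trans _ _ (subset_avg m (fun S : {set 'I_n} =>
     3 * (sqnorm (m%:R^-1 *: \sum_(i in S) g i) + (sqnorm (m%:R^-1 *: \sum_(i in S) ru i) +
       sqnorm (m%:R^-1 *: \sum_(i in S) Nu i)))))).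
    apply: subset_avg_le => S Sm; rewrite /a !big_split/= !scalerDr addrA.
    exact: sqnormD3.
  rewrite subset_avgZ !subset_avgD ler_pM2l// -!addrA addrA.
  apply: lerD; last first.
    apply: lerD; first exact: le_trans (subset_avg_mean_le ru n2 m1 mn) ruW.
    exact: le_trans (subset_avg_mean_le Nu n2 m1 mn) NuB.
  rewrite subset_avg_sqnorm_mean//= -gbarE -/gg.
  pose k : R := (n%:R - m%:R) / (m%:R * (n%:R - 1)).
  have [k0 k1 k2] := sampling_factor_bounds n2 m1 mn (erefl k).
  rewrite -/k.
  rewrite (le_trans (lerD (lexx _) (ler_wpM2l k0 (diversity s.1 s.2))))//.
  rewrite -/gbar -/gg QE.
  have gg0 : 0 <= rho ^+ 2 * gg by rewrite mulr_ge0 ?sqr_ge0 ?sqnorm_ge0.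
  have e1 : k * (rho ^+ 2 * gg) <= rho ^+ 2 * gg by rewrite ler_piMl.
  have e2 : k * delta ^+ 2 <= 2 * (1 - m%:R / n%:R) * delta ^+ 2.
    by rewrite ler_wpM2r ?sqr_ge0.
  by lra.
have wle : n%:R^-1 * \sum_i w i <= eta / Lv * (- (3 / 4 * hh) + Lv * Wm - lv) +
    3 * K * (eta ^+ 2 / Lv) * (hh + Lv * Wm + Pv).
  pose z i := eta / Lv * (- (3 / 4) * sqnorm (h i) + Lv * W i - dotv (h i) (Nv i)) +
    3 * K * (eta ^+ 2 / Lv) * (sqnorm (h i) + Lv * W i + Bv i).
  have -> : eta / Lv * (- (3 / 4 * hh) + Lv * Wm - lv) +
      3 * K * (eta ^+ 2 / Lv) * (hh + Lv * Wm + Pv) = n%:R^-1 * \sum_i z i.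
    have lin (f1 f2 f3 f4 : 'I_n -> R) (c1 c2 L : R) :
        \sum_i (c1 * (- (3 / 4) * f1 i + L * f2 i - f3 i) + c2 * (f1 i + L * f2 i + f4 i)) =
        c1 * (- (3 / 4) * (\sum_i f1 i) + L * (\sum_i f2 i) - \sum_i f3 i) +
        c2 * (\sum_i f1 i + L * (\sum_i f2 i) + \sum_i f4 i).
      by rewrite big_split/= -!mulr_sumr !big_split/= sumrN -!mulr_sumr.
    by rewrite lin /hh /Wm /lv /Pv; field; rewrite !gt_eqF.
  apply: mean_le => i; rewrite /w /z.
  have [_ _ rvW] := updE i.
  have NvB : sqnorm (Nv i) <= Bv i by exact: mean_noise_le.
  have c1 : - dotv (h i) (b i) <= - (3 / 4) * sqnorm (h i) + Lv * W i - dotv (h i) (Nv i).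
    rewrite /b !dotvDr -sqnormE.
    have := @dotv_young _ _ (h i) (- rv i) 4^-1.
    rewrite dotvNr sqnormN divff// invr1 mul1r invr_gt0 ltr0n => /(_ isT).
    by lra.
  have c2 : sqnorm (b i) <= 3 * (sqnorm (h i) + Lv * W i + Bv i).
    by rewrite (le_trans (sqnormD3 _ _ _))// ler_pM2l// !lerD.
  have q1 : 0 <= eta / Lv by rewrite divr_ge0// ltW.
  have q2 : 0 <= K * (eta ^+ 2 / Lv) by rewrite mulr_ge0// divr_ge0 ?sqr_ge0// ltW.
  have := ler_wpM2l q1 c1; have := ler_wpM2l q2 c2.
  by lra.
pose r : R := m%:R / n%:R; rewrite -/r.
have r0 : 0 <= r by rewrite divr_ge0// ltW.
have r1 : r <= 1 by rewrite ler_pdivrMr// mul1r ler_nat.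
pose x := gg / Lu; pose y := hh / Lv; pose D := delta ^+ 2 / Lu.
pose p := Pu / Lu; pose q := Pv / Lv.
have B1 : - (eta / Lu) / m%:R * (r * \sum_i dotv gbar (a i)) <=
    - eta * (3 / 4 * x - Wm) - eta / Lu * lu.
  rewrite [leLHS](_ : _ = eta / Lu * (- dotv gbar (n%:R^-1 *: \sum_i a i))); last first.
    by rewrite dotvZr dotv_sumr /r; field; rewrite !gt_eqF.
  rewrite [leRHS](_ : _ = eta / Lu * (- (3 / 4 * gg) + Lu * Wm - lu)); last first.
    by rewrite /x; field; rewrite !gt_eqF.
  by rewrite ler_wpM2l// divr_ge0// ltW.
have B2 : K * (eta ^+ 2 / Lu) * SQ <=
    3 * K * eta ^+ 2 * (Q * x + 2 * (1 - r) * D + Wm + p).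
  have c0 : 0 <= K * (eta ^+ 2 / Lu) by rewrite mulr_ge0// divr_ge0 ?sqr_ge0// ltW.
  rewrite (le_trans (ler_wpM2l c0 SQle))// le_eqVlt; apply/orP; left; apply/eqP.
  by rewrite /x /D /p /r; field; rewrite !gt_eqF.
have B3 : n%:R^-1 * (r * \sum_i w i) <= r * (eta * (- (3 / 4) * y + Wm) +
    3 * K * eta ^+ 2 * (y + Wm + q)) - r * (eta / Lv) * lv.
  rewrite mulrCA (le_trans (ler_wpM2l r0 wle))// le_eqVlt; apply/orP; left; apply/eqP.
  by rewrite /y /q /r; field; rewrite !gt_eqF.
have linE : noise_lin = - (eta / Lu) * lu - r * (eta / Lv) * lv.
  have -> : lu = n%:R^-1 * \sum_i (tau%:R^-1 * \sum_(k < tau) dotv gbar (xiu i k)).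
    rewrite /lu dotvZr dotv_sumr; congr (_ * _); apply: eq_bigr => i _.
    by rewrite dotvZr dotv_sumr.
  have -> : lv = n%:R^-1 * \sum_i (tau%:R^-1 * \sum_(k < tau) dotv (h i) (xiv i k)).
    by congr (_ * _); apply: eq_bigr => i _; rewrite dotvZr dotv_sumr.
  rewrite !(mulrCA _ n%:R^-1) -mulrBr; congr (_ * _).
  rewrite !mulr_sumr -sumrB; apply: eq_bigr => i _.
  rewrite !(mulrCA _ tau%:R^-1) -mulrBr; congr (_ * _).
  by rewrite !mulr_sumr -sumrB; apply: eq_bigr.
have quadE : noise_quad = (3 * K * eta ^+ 2 + 20 * K * eta ^+ 3 * theta) * p +
    (3 * K * eta ^+ 2 * r + 20 * K * eta ^+ 3 * theta) * q.
  rewrite /p /q [_ * (Pu / _)]mulrCA [_ * (Pv / _)]mulrCA ![Pu * _]mulrC ![Pv * _]mulrC.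
  rewrite /Pu /Pv !(mulrCA _ n%:R^-1) -mulrDr; congr (_ * _).
  rewrite !mulr_sumr -big_split/=; apply: eq_bigr => i _.
  rewrite /Bu /Bv !(mulrCA _ tau%:R^-1) -mulrDr; congr (_ * _).
  by rewrite !mulr_sumr -big_split/=.
have x0 : 0 <= x by rewrite divr_ge0 ?sqnorm_ge0// ltW.
have y0 : 0 <= y by rewrite divr_ge0 ?(ltW Lv0)// mean_ge0// => i; exact: sqnorm_ge0.
have D0 : 0 <= D by rewrite divr_ge0 ?sqr_ge0// ltW.
have p0 : 0 <= p by rewrite divr_ge0 ?(ltW Lu0)// mean_ge0.
have q0 : 0 <= q by rewrite divr_ge0 ?(ltW Lv0)// mean_ge0.
have Wm0 : 0 <= Wm by rewrite mean_ge0.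
have r01 : 0 <= r <= 1 by rewrite r0 r1.
have := round_scalar K1 Q1 eta0 theta0 r01 eta_small eta_small2 x0 y0 D0 p0 q0 Wm0 HW.
rewrite linE quadE -[Delta_u gu s / Lu]/x -[Delta_v gv s / Lv]/y -/D.
by lra.
Qed.

End round.

(** * Independence and decoupling *)

Section decoupling.
Context {d : measure_display} {Omega : measurableType d} {R : realType}.
Variable P : probability Omega R.

(** For fixed [B], both sides are finite measures in [A]: [P] restricted to [B], and [P] scaled by
    the mass of [B]. They agree on the pi-system [G], hence on the sigma-algebra it generates. *)
Lemma indep_event_gen (G : set (set Omega)) (B : set Omega) :
  setI_closed G -> G `<=` measurable -> G setT -> measurable B ->
  (forall A, G A -> P (A `&` B) = P A * P B)%E ->
  forall A, <<s G >> A -> (P (A `&` B) = P A * P B)%E.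
Proof.
move=> GI Gm GT mB GB A sA.
have PBE : P B = (fine (P B))%:E by rewrite fineK// fin_num_measure.
pose c : {nonneg R} := NngNum (fine_ge0 (measure_ge0 P B)).
have H : mrestr P mB A = mscale c P A.
  apply: (@g_sigma_algebra_measure_unique _ R Omega G Gm (fun=> setT)) => //.
  - exact: bigcup_const.
  - move=> A' GA'; rewrite -[LHS]/(P (A' `&` B)) GB// muleC.
    by rewrite [RHS](_ : _ = (fine (P B))%:E * P A')%E // -PBE.
  - move=> _; rewrite [ltLHS](_ : _ = P (setT `&` B)) // setTI.
    by rewrite -ge0_fin_numE // fin_num_measure.
by rewrite -[LHS]/(mrestr P mB A) H muleC PBE.
Qed.

Lemma indep_gen (G H : set (set Omega)) :
  setI_closed G -> G `<=` measurable -> G setT ->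
  setI_closed H -> H `<=` measurable -> H setT ->
  (forall A B, G A -> H B -> P (A `&` B) = P A * P B)%E ->
  forall A B, <<s G >> A -> <<s H >> B -> (P (A `&` B) = P A * P B)%E.
Proof.
move=> GI Gm GT HI Hm HT GH A B sA sB.
have sGm : <<s G >> `<=` measurable.
  by apply: smallest_sub => //; exact: sigma_algebra_measurable.
rewrite setIC muleC; apply: (indep_event_gen HI) => //; first exact: sGm.
move=> B' HB'; rewrite setIC muleC; apply: (indep_event_gen GI) => //.
  exact: Hm.
by move=> A' GA'; exact: GH.
Qed.

(** Independence makes the joint law the product of the marginals, and Tonelli splits it. Both
    variables are then pulled back to [Omega], so the inner integral is again an expectation with
    the first argument frozen. *)
Lemma integral_indep_pair d1 d2 (T1 : measurableType d1) (T2 : measurableType d2)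
    (X : Omega -> T1) (Y : Omega -> T2) (f : T1 * T2 -> \bar R) :
  measurable_fun setT X -> measurable_fun setT Y ->
  (forall A B, measurable A -> measurable B ->
     P (X @^-1` A `&` Y @^-1` B) = P (X @^-1` A) * P (Y @^-1` B))%E ->
  measurable_fun setT f -> (forall x, 0 <= f x)%E ->
  (\int[P]_w f (X w, Y w) = \int[P]_w \int[P]_w' f (X w, Y w'))%E.
Proof.
move=> mX mY XY mf f0.
pose hX := HB.pack_for {mfun Omega >-> T1} X (isMeasurableFun.Build _ _ _ _ _ mX).
pose hY := HB.pack_for {mfun Omega >-> T2} Y (isMeasurableFun.Build _ _ _ _ _ mY).
pose PX : probability T1 R := distribution P hX.
pose PY : probability T2 R := distribution P hY.
pose XY' w := (X w, Y w).
have mXY : measurable_fun setT XY' by apply: measurable_fun_pair.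
pose hXY := HB.pack_for {mfun Omega >-> (T1 * T2)%type} XY'
  (isMeasurableFun.Build _ _ _ _ _ mXY).
have PXYE : forall A, measurable A -> (PX \x PY)%E A = distribution P hXY A.
  by apply: product_measure_unique => A B mA mB; exact: XY.
transitivity (\int[distribution P hXY]_x f x)%E.
  by rewrite ge0_integral_pushforward.
rewrite (eq_measure_integral (PX \x PY)%E); last by move=> A mA _; exact/esym/PXYE.
rewrite fubini_tonelli1 // ge0_integral_pushforward //; last 2 first.
- exact: measurable_fun_fubini_tonelli_F.
- by move=> x _; apply: integral_ge0.
apply: eq_integral => w _; rewrite /= /fubini_F ge0_integral_pushforward //.
by apply: measurableT_comp => //; exact: measurable_pair1.
Qed.

(* The two copies of [Omega] carry the sigma-algebras generated by [G] and [H]. *)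
Lemma integral_decouple (G H : set (set Omega)) :
  setI_closed G -> G `<=` measurable -> G setT ->
  setI_closed H -> H `<=` measurable -> H setT ->
  (forall A B, G A -> H B -> P (A `&` B) = P A * P B)%E ->
  forall f : (g_sigma_algebraType G : measurableType _) *
             (g_sigma_algebraType H : measurableType _) -> \bar R,
  measurable_fun setT f -> (forall x, 0 <= f x)%E ->
  (\int[P]_w f (w, w) = \int[P]_w \int[P]_w' f (w, w'))%E.
Proof.
move=> GI Gm GT HI Hm HT GH f mf f0.
have sm K : K `<=` measurable -> <<s K >> `<=` @measurable _ Omega.
  by move=> Km; apply: smallest_sub => //; exact: sigma_algebra_measurable.
apply: (integral_indep_pair (X := id : Omega -> (g_sigma_algebraType G : measurableType _))
  (Y := id : Omega -> (g_sigma_algebraType H : measurableType _))) => //.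
- by move=> _ A mA; rewrite setTI; exact: (sm _ Gm).
- by move=> _ A mA; rewrite setTI; exact: (sm _ Hm).
- by move=> A B mA mB; exact: (indep_gen GI Gm GT HI Hm HT).
Qed.

End decoupling.

(** The pi-system of finite intersections over sources in [J]. Duplicate-free lists match the form
    of [mutually_independent]. *)
Definition joint_events {T : Type} {I : eqType} (E : I -> set (set T)) (J : pred I)
    : set (set T) :=
  [set B | exists js : seq I, exists A : I -> set T,
    [/\ uniq js, {subset js <= J}, forall j, j \in js -> E j (A j) &
        B = \bigcap_(j in [set j | j \in js]) A j]].

Section joint_events.
Context {d : measure_display} {Omega : measurableType d} {R : realType}.
Variables (P : probability Omega R) (I : eqType) (E : I -> set (set Omega)).
Hypothesis Em : forall j, E j `<=` measurable.
Hypothesis ET : forall j, E j setT.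
Hypothesis EI : forall j, setI_closed (E j).
Implicit Type J : pred I.

Lemma joint_eventsT J : joint_events E J setT.
Proof.
exists [::], (fun=> setT); split => //.
by apply/seteqP; split.
Qed.

Lemma joint_events_measurable J : joint_events E J `<=` measurable.
Proof.
move=> _ [js [A [_ _ EA ->]]].
apply: fin_bigcap_measurable => [|j /= jjs]; first exact: finite_seq.
exact/Em/EA.
Qed.

Lemma joint_events1 J j A : j \in J -> E j A -> joint_events E J A.
Proof.
move=> jJ EA; exists [:: j], (fun=> A); split => //.
- by move=> k; rewrite inE => /eqP ->.
- by move=> k; rewrite inE => /eqP ->.
- apply/seteqP; split => [x Ax k|x] //=; apply; exact: mem_head.
Qed.

Lemma joint_eventsI J : setI_closed (joint_events E J).
Proof.
move=> _ _ [s [A [us sJ EA ->]]] [s' [A' [us' sJ' EA' ->]]].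
exists (undup (s ++ s')), (fun j => (if j \in s then A j else setT) `&`
  (if j \in s' then A' j else setT)); split.
- exact: undup_uniq.
- by move=> j; rewrite mem_undup mem_cat => /orP[/sJ|/sJ'].
- move=> j _; apply: EI; case: ifPn => //; [exact: EA|exact: EA'].
- apply/seteqP; split => [x [Ax A'x] j _|x H].
    by split; case: ifPn => // js; [exact: Ax|exact: A'x].
  split=> j /= js; have [|] := H j; rewrite /= ?mem_undup ?mem_cat ?js ?orbT//.
Qed.

(** Disjointness of [J] and [K] keeps the concatenated list duplicate-free, so mutual independence
    applies to it at once and the product splits at the junction. *)
Lemma joint_events_indep (J K : pred I) :
  mutually_independent P E -> [predI J & K] =i pred0 ->
  forall A B, joint_events E J A -> joint_events E K B ->
  (P (A `&` B) = P A * P B)%E.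
Proof.
move=> iE JK _ _ [s [A [us sJ EA ->]]] [s' [B [us' sK EB ->]]].
pose C j := if j \in s then A j else B j.
have dis j : j \in s' -> j \notin s.
  move=> js'; apply/negP => js; have := JK j.
  by rewrite !inE/= -!topredE/= => /negP; apply; rewrite [J j]sJ// [K j]sK.
rewrite [X in P X](_ : _ = \bigcap_(j in [set j | j \in s ++ s']) C j).
  rewrite iE; last 2 first.
  - by rewrite cat_uniq us us' andbT -all_predC; apply/allP => j /dis.
  - by move=> j; rewrite mem_cat /C; case: ifPn => [js _|_ /= js']; [exact: EA|exact: EB].
  rewrite big_cat/= iE// iE//; congr (_ * _)%E; apply: eq_big_seq => j js.
    by rewrite /C js.
  by rewrite /C (negbTE (dis _ js)).
apply/seteqP; split => [x [Ax Bx] j /=|x H].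
  by rewrite mem_cat /C; case: ifPn => [js _|_ /= js']; [exact: Ax|exact: Bx].
split=> j /= js.
  by have := H j; rewrite /= mem_cat js /C js; exact.
by have := H j; rewrite /= mem_cat js orbT /C (negbTE (dis _ js)); exact.
Qed.

(** [Omega] with a coarser sigma-algebra: measurability on it expresses dependence on the sources in
    [J] only. *)
Definition sub_space J : measurableType _ := g_sigma_algebraType (joint_events E J).

Lemma integral_decouple_joint (J K : pred I) :
  mutually_independent P E -> [predI J & K] =i pred0 ->
  forall f : sub_space J * sub_space K -> \bar R,
  measurable_fun setT f -> (forall x, 0 <= f x)%E ->
  (\int[P]_w f (w, w) = \int[P]_w \int[P]_w' f (w, w'))%E.
Proof.
move=> iE JK f mf f0; apply: integral_decouple mf f0 => //;
  try exact: joint_eventsI; try exact: joint_events_measurable;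
  try exact: joint_eventsT.
exact: joint_events_indep.
Qed.

Lemma sub_space_measurable J (A : set Omega) :
  @measurable _ (sub_space J) A -> measurable A.
Proof.
move: A; apply: smallest_sub; first exact: sigma_algebra_measurable.
exact: joint_events_measurable.
Qed.

Lemma sub_spaceP J d' (T : measurableType d') (X : Omega -> T) :
  measurable_fun setT (X : sub_space J -> T) -> measurable_fun setT X.
Proof.
by move=> mX _ A mA; apply: (@sub_space_measurable J); exact: mX.
Qed.

Lemma sub_space_rv J j T (X : Omega -> T) (meas : set (set T)) :
  j \in J -> E j = rv_events X meas ->
  forall A, meas A -> @measurable _ (sub_space J) (X @^-1` A).
Proof.
move=> jJ Ej A mA; apply: sub_sigma_algebra; apply: (joint_events1 jJ).
by rewrite Ej; exists A.
Qed.

End joint_events.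

(** * Measurability *)

Definition vec_measurable {dW : measure_display} {W : measurableType dW} {R : realType}
    {n : nat} (x : W -> 'rV[R]_n) : Prop :=
  forall j, measurable_fun setT (fun w => x w 0 j).

Section vec_measurable.
Context {dW : measure_display} {W : measurableType dW} {R : realType}.

Lemma measurable_bigsum I (r : seq I) (p : pred I) (f : I -> W -> R) :
  (forall i, measurable_fun setT (f i)) ->
  measurable_fun setT (fun w => \sum_(i <- r | p i) f i w).
Proof.
move=> mf; elim: r => [|i r IH].
  by under eq_fun do rewrite big_nil; exact: measurable_cst.
under eq_fun do rewrite big_cons.
by case: (p i) => //; exact: measurable_funD.
Qed.

Lemma vec_measurable_cst n (c : 'rV[R]_n) : vec_measurable (fun _ : W => c).
Proof. by move=> j; exact: measurable_cst. Qed.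

Lemma vec_measurableD n (x y : W -> 'rV[R]_n) :
  vec_measurable x -> vec_measurable y -> vec_measurable (fun w => x w + y w).
Proof.
by move=> mx my j; under eq_fun do rewrite mxE; exact: measurable_funD.
Qed.

Lemma vec_measurableZ n a (x : W -> 'rV[R]_n) :
  vec_measurable x -> vec_measurable (fun w => a *: x w).
Proof.
by move=> mx j; under eq_fun do rewrite mxE; exact: measurable_funM.
Qed.

Lemma vec_measurableN n (x : W -> 'rV[R]_n) :
  vec_measurable x -> vec_measurable (fun w => - x w).
Proof.
by move=> mx; under eq_fun do rewrite -scaleN1r; exact: vec_measurableZ.
Qed.

Lemma vec_measurableB n (x y : W -> 'rV[R]_n) :
  vec_measurable x -> vec_measurable y -> vec_measurable (fun w => x w - y w).
Proof. by move=> mx my; apply: vec_measurableD => //; exact: vec_measurableN. Qed.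

Lemma vec_measurable_sum n I (r : seq I) (p : pred I) (x : I -> W -> 'rV[R]_n) :
  (forall i, vec_measurable (x i)) ->
  vec_measurable (fun w => \sum_(i <- r | p i) x i w).
Proof.
move=> mx j; under eq_fun do rewrite summxE.
by apply: measurable_bigsum => i; exact: mx.
Qed.

Lemma measurable_sqnorm n (x : W -> 'rV[R]_n) :
  vec_measurable x -> measurable_fun setT (fun w => sqnorm (x w)).
Proof.
move=> mx; apply: measurable_bigsum => j; under eq_fun do rewrite expr2.
exact: measurable_funM.
Qed.

Lemma measurable_dotv n (x y : W -> 'rV[R]_n) :
  vec_measurable x -> vec_measurable y ->
  measurable_fun setT (fun w => dotv (x w) (y w)).
Proof. by move=> mx my; apply: measurable_bigsum => j; exact: measurable_funM. Qed.

Lemma measurable_tuple_of_vec n (x : W -> 'rV[R]_n) :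
  vec_measurable x -> measurable_fun setT (fun w => [tuple x w 0 j | j < n]).
Proof.
move=> mx; apply/measurable_fun_tnthP => j.
rewrite (_ : _ \o _ = fun w => x w 0 j); first exact: mx.
by apply/funext => w; rewrite /= tnth_mktuple.
Qed.

Lemma t2rv_mktuple n (x : 'rV[R]_n) : t2rv [tuple x 0 j | j < n] = x.
Proof. by apply/rowP => j; rewrite mxE tnth_mktuple. Qed.

Lemma vec_measurable_comp3 dZ (Z : measurableType dZ) a b c
    (G : 'rV[R]_a -> 'rV[R]_b -> Z -> 'rV[R]_c) x y (z : W -> Z) :
  (forall j, measurable_fun setT
    (fun p : ((a.-tuple R * b.-tuple R) * Z)%type => G (t2rv p.1.1) (t2rv p.1.2) p.2 0 j)) ->
  vec_measurable x -> vec_measurable y -> measurable_fun setT z ->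
  vec_measurable (fun w => G (x w) (y w) (z w)).
Proof.
move=> mG mx my mz j.
pose T w : (a.-tuple R * b.-tuple R) * Z :=
  (([tuple x w 0 j | j < a], [tuple y w 0 j | j < b]), z w).
have mT : measurable_fun setT T.
  apply: measurable_fun_pair => //; apply: measurable_fun_pair;
    exact: measurable_tuple_of_vec.
rewrite (_ : (fun w => _) = (fun p : ((a.-tuple R * b.-tuple R) * Z)%type =>
    G (t2rv p.1.1) (t2rv p.1.2) p.2 0 j) \o T); first exact: measurableT_comp.
by apply/funext => w; rewrite /= !t2rv_mktuple.
Qed.

End vec_measurable.

(** Measurability of a gradient comes from unbiasedness: it is a parameter integral of the jointly
    measurable [G], so Tonelli applies to its positive and negative parts. *)
Lemma vec_measurable_mean {dW : measure_display} {W : measurableType dW} {R : realType}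
    dZ (Z : measurableType dZ) (D : probability Z R) a b c
    (G : 'rV[R]_a -> 'rV[R]_b -> Z -> 'rV[R]_c) (g : 'rV[R]_a -> 'rV[R]_b -> 'rV[R]_c)
    (x : W -> 'rV[R]_a) (y : W -> 'rV[R]_b) :
  (forall j, measurable_fun setT
    (fun p : ((a.-tuple R * b.-tuple R) * Z)%type => G (t2rv p.1.1) (t2rv p.1.2) p.2 0 j)) ->
  (forall u v j, D.-integrable setT (fun z => (G u v z 0 j)%:E)) ->
  (forall u v j, \int[D]_z (G u v z 0 j)%:E = (g u v 0 j)%:E)%E ->
  vec_measurable x -> vec_measurable y -> vec_measurable (fun w => g (x w) (y w)).
Proof.
move=> mG iG Gg mx my j.
pose f (p : W * Z) := (G (x p.1) (y p.1) p.2 0 j)%:E.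
have mf : measurable_fun setT f.
  apply/measurable_EFinP; apply: (vec_measurable_comp3 mG) => // k.
    exact: (measurableT_comp (mx k)).
  exact: (measurableT_comp (my k)).
rewrite (_ : (fun w => _) = (fun w => fine (\int[D]_z (f^\+)%E (w, z)) -
    fine (\int[D]_z (f^\-)%E (w, z)))%R).
  apply: measurable_funB; apply: (measurableT_comp (fine_measurable measurableT)).
  - by apply: measurable_fun_fubini_tonelli_F => //; exact: measurable_funepos.
  - by apply: measurable_fun_fubini_tonelli_F => //; exact: measurable_funeneg.
apply/funext => w; apply: EFin_inj.
have iw := iG (x w) (y w) j.
under [X in fine X - _]eq_integral do rewrite funeposE -[f _]/((fun z => f (w, z)) _) -funeposE.
under [X in _ - fine X]eq_integral do rewrite funenegE -[f _]/((fun z => f (w, z)) _) -funenegE.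
rewrite EFinB !fineK; last 2 first.
- exact: (integrable_neg_fin_num measurableT iw).
- exact: (integrable_pos_fin_num measurableT iw).
rewrite -Gg; exact: integralE.
Qed.

Section measurable_loss.
Context {dW : measure_display} {W : measurableType dW} {R : realType} {n : nat}.

(* Only coordinates of vectors are known to be measurable, so continuity does not give
   measurability of a loss; it is a limit of Riemann sums of its gradient instead. *)
Lemma measurable_riemann (f : W -> 'rV[R]_n -> R) (g : W -> 'rV[R]_n -> 'rV[R]_n) (L : R)
    (x : W -> 'rV[R]_n) :
  0 < L -> (forall w x h, is_derive x h (f w) (dotv (g w x) h)) ->
  (forall w x y, sqnorm (g w x - g w y) <= L ^+ 2 * sqnorm (x - y)) ->
  measurable_fun setT (f ^~ 0) -> vec_measurable x ->
  (forall y, vec_measurable y -> vec_measurable (fun w => g w (y w))) ->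
  measurable_fun setT (fun w => f w (x w)).
Proof.
move=> L0 fg gL mf0 mx mg.
apply: (measurable_fun_cvg (h := fun N w => f w 0 + \sum_(l < N.+1)
     dotv (g w ((l%:R / N.+1%:R) *: x w)) (N.+1%:R^-1 *: x w))).
  move=> N; apply: measurable_funD => //; apply: measurable_bigsum => l.
  apply: measurable_dotv; last exact: vec_measurableZ.
  by apply: mg; exact: vec_measurableZ.
by move=> w _; exact: (riemann_sum_cvg L0 (fg w) (gL w)).
Qed.

End measurable_loss.

(** The Riemann argument is used along two legs: from [(0, 0)] to [(0, y)] in the second block, then
    to [(x, y)] in the first. *)
Lemma measurable_loss {dW : measure_display} {W : measurableType dW} {R : realType}
    (a b : nat) (F : 'rV[R]_a -> 'rV[R]_b -> R) gu gv (Lu Lv : R)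
    (x : W -> 'rV[R]_a) (y : W -> 'rV[R]_b) :
  0 < Lu -> 0 < Lv ->
  (forall u v h, is_derive u h (fun x => F x v) (dotv (gu u v) h)) ->
  (forall u v h, is_derive v h (fun y => F u y) (dotv (gv u v) h)) ->
  (forall u u' v, enorm (gu u v - gu u' v) <= Lu * enorm (u - u')) ->
  (forall u v v', enorm (gv u v - gv u v') <= Lv * enorm (v - v')) ->
  (forall x y, vec_measurable x -> vec_measurable y ->
     vec_measurable (fun w : W => gu (x w) (y w))) ->
  (forall x y, vec_measurable x -> vec_measurable y ->
     vec_measurable (fun w : W => gv (x w) (y w))) ->
  vec_measurable x -> vec_measurable y ->
  measurable_fun setT (fun w => F (x w) (y w)).
Proof.
move=> Lu0 Lv0 Fu Fv guu gvv mgu mgv mx my.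
apply: (measurable_riemann (f := fun w u => F u (y w)) (g := fun w u => gu u (y w)) Lu0) => //.
- by move=> w u u'; exact: enorm_le_sqnorm.
- apply: (measurable_riemann (f := fun w v => F 0 v) (g := fun w v => gv 0 v) Lv0) => //.
  + by move=> w v v'; exact: enorm_le_sqnorm.
  + by move=> z mz; apply: mgv => //; exact: vec_measurable_cst.
- by move=> z mz; exact: mgu.
Qed.

Section measurable_fedsim.
Context {R : realType} {dZ : measure_display} {Z : measurableType dZ}.

(** Only samples before step [k] are asked to be measurable, so that the lemma applies on the
    sigma-algebra of the local past. *)
Lemma vec_measurable_local_iter {dW : measure_display} {W : measurableType dW} (a b : nat)
    (Gu : 'rV[R]_a -> 'rV[R]_b -> Z -> 'rV[R]_a) (Gv : 'rV[R]_a -> 'rV[R]_b -> Z -> 'rV[R]_b)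
    (gamu gamv : R) (zs : W -> nat -> Z) (u : W -> 'rV[R]_a) (v : W -> 'rV[R]_b) (k : nat) :
  (forall j, measurable_fun setT
    (fun p : ((a.-tuple R * b.-tuple R) * Z)%type => Gu (t2rv p.1.1) (t2rv p.1.2) p.2 0 j)) ->
  (forall j, measurable_fun setT
    (fun p : ((a.-tuple R * b.-tuple R) * Z)%type => Gv (t2rv p.1.1) (t2rv p.1.2) p.2 0 j)) ->
  vec_measurable u -> vec_measurable v ->
  (forall l, (l < k)%N -> measurable_fun setT (zs ^~ l)) ->
  let p w := local_iter Gu Gv gamu gamv (zs w) (u w, v w) k in
  vec_measurable (fun w => (p w).1) /\ vec_measurable (fun w => (p w).2).
Proof.
move=> mGu mGv mu mv; elim: k => [|k IH] mz //=.
have [|m1 m2] := IH; first by move=> l lk; apply: mz; exact: ltnW.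
split; apply: vec_measurableB => //; apply: vec_measurableZ.
- by apply: (vec_measurable_comp3 mGu) => //; exact: mz.
- by apply: (vec_measurable_comp3 mGv) => //; exact: mz.
Qed.

Lemma measurable_mem_set {dW : measure_display} {W : measurableType dW} (n : nat)
    (S : W -> {set 'I_n}) (i : 'I_n) :
  (forall A, measurable (S @^-1` [set A])) -> measurable_fun setT (fun w => i \in S w).
Proof.
move=> mS; apply: (measurable_fun_bool true).
rewrite setTI (_ : _ @^-1` _ = \bigcup_(A in [set A : {set 'I_n} | i \in A]) S @^-1` [set A]).
  by apply: fin_bigcup_measurable => // ; exact: finite_finset.
by apply/seteqP; split => [w /= iS|w [A iA /= AE]] //; [exists (S w)|rewrite /= AE].
Qed.

(** The domain [W] is arbitrary because it will be a sub-sigma-algebra of [Omega] or a product of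
    two, with selection, samples and state reading different components. *)
Lemma vec_measurable_round {dW : measure_display} {W : measurableType dW}
    (n d0 : nat) (dv : 'I_n -> nat)
    (Gu : forall i : 'I_n, 'rV[R]_d0 -> 'rV[R]_(dv i) -> Z -> 'rV[R]_d0)
    (Gv : forall i : 'I_n, 'rV[R]_d0 -> 'rV[R]_(dv i) -> Z -> 'rV[R]_(dv i))
    (m tau : nat) (gamu gamv : R) (S : W -> {set 'I_n}) (zs : W -> 'I_n -> nat -> Z)
    (s : W -> fstate R n d0 dv) :
  (forall i j, measurable_fun setT (fun p : ((d0.-tuple R * (dv i).-tuple R) * Z)%type =>
     Gu i (t2rv p.1.1) (t2rv p.1.2) p.2 0 j)) ->
  (forall i j, measurable_fun setT (fun p : ((d0.-tuple R * (dv i).-tuple R) * Z)%type =>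
     Gv i (t2rv p.1.1) (t2rv p.1.2) p.2 0 j)) ->
  (forall A, measurable (S @^-1` [set A])) ->
  (forall i k, measurable_fun setT (fun w => zs w i k)) ->
  vec_measurable (fun w => (s w).1) -> (forall i, vec_measurable (fun w => (s w).2 i)) ->
  let s' w := fedsim_round Gu Gv m tau gamu gamv (S w) (zs w) (s w) in
  vec_measurable (fun w => (s' w).1) /\ (forall i, vec_measurable (fun w => (s' w).2 i)).
Proof.
move=> mGu mGv mS mz m1 m2 /=.
have mi i := @vec_measurable_local_iter _ W _ _ (Gu i) (Gv i) gamu gamv
  (fun w => zs w i) (fun w => (s w).1) (fun w => (s w).2 i) tau (mGu i) (mGv i) m1 (m2 i)
  (fun l _ => mz i l).
split=> [|i].
- apply: vec_measurableZ; under eq_fun do rewrite big_mkcond.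
  apply: vec_measurable_sum => i j.
  rewrite (_ : (fun w => _) = (fun w => if i \in S w then
    (local_iter (Gu i) (Gv i) gamu gamv (zs w i) ((s w).1, (s w).2 i) tau).1 0 j else 0)).
    apply: measurable_fun_ifT => //; first exact: measurable_mem_set.
    by have [+ _] := mi i; exact.
  by apply/funext => w; case: ifP; rewrite ?mxE.
- move=> j.
  rewrite (_ : (fun w => _) = (fun w => if i \in S w then
    (local_iter (Gu i) (Gv i) gamu gamv (zs w i) ((s w).1, (s w).2 i) tau).2 0 j
    else (s w).2 i 0 j)).
    apply: measurable_fun_ifT => //; first exact: measurable_mem_set.
      by have [_ +] := mi i; exact.
    exact: m2.
  by apply/funext => w; case: ifP.
Qed.

End measurable_fedsim.

(** * Expectations *)

Section expectation.
Context {d : measure_display} {Omega : measurableType d} {R : realType}.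
Variable P : probability Omega R.

Lemma ge0_le_integralT (f g : Omega -> \bar R) :
  (forall w, 0 <= f w)%E -> (forall w, f w <= g w)%E ->
  (\int[P]_w f w <= \int[P]_w g w)%E.
Proof.
move=> f0 fg; have g0 w : (0 <= g w)%E by exact: le_trans (fg w).
rewrite !ge0_integralTE//; apply: le_ereal_sup => _ [h hf <-].
by exists h => // w; exact: le_trans (fg w).
Qed.

Lemma integral_law dT (T : measurableType dT) (D : probability T R) (X : Omega -> T)
    (f : T -> \bar R) :
  measurable_fun setT X -> (forall B, measurable B -> P (X @^-1` B) = D B) ->
  measurable_fun setT f -> (forall x, 0 <= f x)%E ->
  (\int[P]_w f (X w) = \int[D]_x f x)%E.
Proof.
move=> mX XD mf f0.
pose hX := HB.pack_for {mfun Omega >-> T} X (isMeasurableFun.Build _ _ _ _ _ mX).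
rewrite [RHS](eq_measure_integral (distribution P hX)); last first.
  by move=> A mA _; exact/esym/XD.
by rewrite ge0_integral_pushforward.
Qed.

(** Linear noise is signed, so integrability is carried along; for the quadratic noise,
    nonnegativity and a finite bound, as in [mean_le], imply it. *)
Definition centered (f : Omega -> R) : Prop :=
  P.-integrable setT (EFin \o f) /\ (\int[P]_w (f w)%:E = 0)%E.

Lemma centered0 : centered (fun=> 0).
Proof. by split; [exact: integrable0|exact: integral0]. Qed.

Lemma centeredD f g : centered f -> centered g -> centered (fun w => f w + g w).
Proof.
move=> [f1 f2] [g1 g2]; split; first exact: (integrableD measurableT f1 g1).
transitivity (\int[P]_w ((EFin \o f) w + (EFin \o g) w))%E; first by [].
by rewrite (integralD measurableT f1 g1) /= f2 g2 adde0.
Qed.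

Lemma centeredZ a f : centered f -> centered (fun w => a * f w).
Proof.
move=> [f1 f2]; split; first exact: (integrableZl measurableT a f1).
transitivity (\int[P]_w (a%:E * (EFin \o f) w))%E; first by [].
by rewrite (integralZl measurableT f1) /= f2 mule0.
Qed.

Lemma centeredB f g : centered f -> centered g -> centered (fun w => f w - g w).
Proof.
by move=> fc gc; under eq_fun do rewrite -mulN1r; apply: centeredD => //; exact: centeredZ.
Qed.

Lemma centered_sum I (r : seq I) (p : pred I) (f : I -> Omega -> R) :
  (forall i, centered (f i)) -> centered (fun w => \sum_(i <- r | p i) f i w).
Proof.
move=> fc; elim: r => [|i r IH].
  by under eq_fun do rewrite big_nil; exact: centered0.
under eq_fun do rewrite big_cons.
by case: (p i) => //; exact: centeredD.
Qed.

Definition mean_le (f : Omega -> R) (c : R) : Prop :=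
  [/\ measurable_fun setT f, forall w, 0 <= f w & (\int[P]_w (f w)%:E <= c%:E)%E].

Lemma mean_le0 : mean_le (fun=> 0) 0.
Proof. by split => //; rewrite integral0. Qed.

Lemma mean_leD f g a b : mean_le f a -> mean_le g b -> mean_le (fun w => f w + g w) (a + b).
Proof.
move=> [mf f0 fa] [mg g0 gb]; split.
- exact: measurable_funD.
- by move=> w; rewrite addr_ge0.
- under eq_integral do rewrite EFinD.
  rewrite ge0_integralD//; first by rewrite EFinD leeD.
  + by move=> w _; rewrite lee_fin.
  + exact/measurable_EFinP.
  + by move=> w _; rewrite lee_fin.
  + exact/measurable_EFinP.
Qed.

Lemma mean_leZ f a c : 0 <= a -> mean_le f c -> mean_le (fun w => a * f w) (a * c).
Proof.
move=> a0 [mf f0 fc]; split.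
- exact: measurable_funM.
- by move=> w; rewrite mulr_ge0.
- under eq_integral do rewrite EFinM.
  rewrite ge0_integralZl//; first by rewrite EFinM lee_wpmul2l ?lee_fin.
  + exact/measurable_EFinP.
  + by move=> w _; rewrite lee_fin.
Qed.

Lemma mean_le_sum I (r : seq I) (p : pred I) (f : I -> Omega -> R) (c : I -> R) :
  (forall i, mean_le (f i) (c i)) ->
  mean_le (fun w => \sum_(i <- r | p i) f i w) (\sum_(i <- r | p i) c i).
Proof.
move=> fc; elim: r => [|i r IH].
  by under eq_fun do rewrite big_nil; rewrite big_nil; exact: mean_le0.
under eq_fun do rewrite big_cons; rewrite big_cons.
by case: (p i) => //; exact: mean_leD.
Qed.

Lemma mean_le_integrable f c : mean_le f c -> P.-integrable setT (EFin \o f).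
Proof.
move=> [mf f0 fc]; apply/integrableP; split; first exact/measurable_EFinP.
under eq_integral do rewrite /= ger0_norm//.
exact: le_lt_trans fc (ltry _).
Qed.

Lemma integral_affine (c : R) f g e : centered f -> mean_le g e ->
  (\int[P]_w (c + f w + g w)%:E <= (c + e)%:E)%E.
Proof.
move=> [f1 f2] ge; have g1 := mean_le_integrable ge; have [_ _ gc] := ge.
have c1 : P.-integrable setT (EFin \o (fun=> c)) by exact: finite_measure_integrable_cst.
pose cf w := c + f w.
have cf1 : P.-integrable setT (EFin \o cf) by exact: (integrableD measurableT c1 f1).
rewrite -[leLHS]/(\int[P]_w ((EFin \o cf) w + (EFin \o g) w))%E.
rewrite (integralD measurableT cf1 g1)/= EFinD leeD//.
rewrite -[leLHS]/(\int[P]_w ((EFin \o (fun=> c)) w + (EFin \o f) w))%E.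
rewrite (integralD measurableT c1 f1)/= f2 adde0 integral_cst//. 
by rewrite [X in (_ * X)%E](probability_setT P) mule1.
Qed.

End expectation.

(** * Expectations of the selection and of the gradient noise *)

Section sources.
Context {dO : measure_display} {Omega : measurableType dO} {R : realType} {n : nat}
  {dZ : measure_display} {Z : measurableType dZ}.
Variables (P : probability Omega R) (D : 'I_n -> probability Z R) (m : nat)
  (Ssel : nat -> Omega -> {set 'I_n}) (z : nat -> 'I_n -> nat -> Omega -> Z).

Local Notation source := (nat + (nat * 'I_n * nat))%type.
Implicit Type J : pred source.

Definition source_events (j : source) : set (set Omega) :=
  match j with
  | inl t => rv_events (Ssel t) setT
  | inr tik => rv_events (z tik.1.1 tik.1.2 tik.2) measurable
  end.

Definition past (t : nat) : pred source :=
  fun j => match j with inl s => (s < t)%N | inr tik => (tik.1.1 < t)%N end.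
Definition at_round (t : nat) : pred source :=
  fun j => match j with inl s => s == t | inr tik => tik.1.1 == t end.
Definition selection (t : nat) : pred source :=
  fun j => match j with inl s => s == t | inr _ => false end.
Definition samples (t : nat) : pred source :=
  fun j => match j with inl _ => false | inr tik => tik.1.1 == t end.
Definition local_past (t : nat) (i : 'I_n) (k : nat) : pred source :=
  fun j => match j with
           | inl _ => false
           | inr tik => [&& tik.1.1 == t, tik.1.2 == i & (tik.2 < k)%N]
           end.
Definition local_sample (t : nat) (i : 'I_n) (k : nat) : pred source :=
  fun j => j == inr (t, i, k).

Hypothesis Sm : forall t S, measurable (Ssel t @^-1` [set S]).
Hypothesis SP : forall t S, P (Ssel t @^-1` [set S]) =
  (if #|S| == m then ('C(n, m)%:R)^-1 else 0)%:E.
Hypothesis zm : forall t i k, measurable_fun setT (z t i k).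
Hypothesis zD : forall t i k B, measurable B -> P (z t i k @^-1` B) = D i B.
Hypothesis indep : mutually_independent P source_events.

Lemma source_events_measurable j : source_events j `<=` measurable.
Proof.
case: j => [t|[[t i] k]] _ [B mB <-] /=; last by rewrite -[X in measurable X]setTI; exact: zm.
rewrite (_ : _ @^-1` _ = \bigcup_(A in B) Ssel t @^-1` [set A]).
  by apply: fin_bigcup_measurable => //; exact: finite_finset.
by apply/seteqP; split => [w Bw|w [A BA /= AE]]; [exists (Ssel t w)|rewrite /= AE].
Qed.

Lemma source_eventsT j : source_events j setT.
Proof. by case: j => [t|[[t i] k]]; exists setT => //; rewrite preimage_setT. Qed.

Lemma source_eventsI j : setI_closed (source_events j).
Proof.
case: j => [t|[[t i] k]] _ _ [A mA <-] [B mB <-] /=; exists (A `&` B) => //.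
exact: measurableI.
Qed.

Definition src (J : pred source) : measurableType _ :=
  sub_space source_events J.

Lemma src_decouple (J K : pred source) :
  (forall j, ~~ (J j && K j)) ->
  forall f : src J * src K -> \bar R, measurable_fun setT f -> (forall x, 0 <= f x)%E ->
  (\int[P]_w f (w, w) = \int[P]_w \int[P]_w' f (w, w'))%E.
Proof.
move=> JK; apply: integral_decouple_joint => //.
- exact: source_events_measurable.
- exact: source_eventsT.
- exact: source_eventsI.
- by move=> j; apply/negbTE; exact: JK.
Qed.

Lemma src_sample J t i k : J (inr (t, i, k)) ->
  measurable_fun setT (z t i k : src J -> Z).
Proof.
move=> Jj _ B mB; rewrite setTI.
exact: (@sub_space_rv _ _ _ source_events J (inr (t, i, k)) _ (z t i k) measurable).
Qed.

Lemma src_selection J t S : J (inl t) -> @measurable _ (src J) (Ssel t @^-1` [set S]).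
Proof.
by move=> Jj; exact: (@sub_space_rv _ _ _ source_events J (inl t) _ (Ssel t) setT).
Qed.

Lemma src_selection_comp dW (W : measurableType dW) J t (phi : W -> src J) S :
  J (inl t) -> measurable_fun setT phi ->
  measurable ((fun x => Ssel t (phi x)) @^-1` [set S]).
Proof. by move=> Jt mphi; have := mphi measurableT _ (src_selection S Jt); rewrite setTI. Qed.

Lemma src_measurable J d' (T : measurableType d') (X : Omega -> T) :
  measurable_fun setT (X : src J -> T) -> measurable_fun setT X.
Proof. by apply: sub_spaceP; exact: source_events_measurable. Qed.

Lemma selection_mean t (f : {set 'I_n} -> R) : (forall S, 0 <= f S) ->
  (\int[P]_w (f (Ssel t w))%:E = (subset_avg m f)%:E)%E.
Proof.
move=> f0.
have ind (w : Omega) : (f (Ssel t w))%:E =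
    (\sum_(S : {set 'I_n}) (f S)%:E * (\1_(Ssel t @^-1` [set S]) w)%:E)%E.
  rewrite (bigD1 (Ssel t w))//= indicE mem_set//= mule1 big1 ?adde0// => S SN.
  rewrite indicE memNset ?mule0//= => SE; by rewrite SE eqxx in SN.
under eq_integral do rewrite ind.
rewrite ge0_integral_sum//; last 2 first.
- by move=> S; apply/measurable_EFinP; apply: measurable_funM => //; exact: measurable_indic.
- by move=> S w _; rewrite mule_ge0 ?lee_fin.
rewrite /subset_avg mulr_sumr [in RHS]big_mkcond -sumEFin; apply: eq_bigr => S _.
rewrite ge0_integralZl ?lee_fin//; last first.
  by apply/measurable_EFinP; exact: measurable_indic.
rewrite integral_indic// setIT [X in (_ * X)%E]SP.
by case: ifP => _; rewrite -EFinM ?mulr0// mulrC.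
Qed.

Section noise.
Context {a b c : nat}.
Variables (t : nat) (i : 'I_n) (k : nat).
Variables (Gu : 'rV[R]_a -> 'rV[R]_b -> Z -> 'rV[R]_a)
          (Gv : 'rV[R]_a -> 'rV[R]_b -> Z -> 'rV[R]_b)
          (G : 'rV[R]_a -> 'rV[R]_b -> Z -> 'rV[R]_c)
          (g : 'rV[R]_a -> 'rV[R]_b -> 'rV[R]_c).
Variables (gamu gamv sig : R) (u : 'rV[R]_a) (v : 'rV[R]_b).
Hypothesis mGu : forall j, measurable_fun setT
  (fun p : ((a.-tuple R * b.-tuple R) * Z)%type => Gu (t2rv p.1.1) (t2rv p.1.2) p.2 0 j).
Hypothesis mGv : forall j, measurable_fun setT
  (fun p : ((a.-tuple R * b.-tuple R) * Z)%type => Gv (t2rv p.1.1) (t2rv p.1.2) p.2 0 j).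
Hypothesis mG : forall j, measurable_fun setT
  (fun p : ((a.-tuple R * b.-tuple R) * Z)%type => G (t2rv p.1.1) (t2rv p.1.2) p.2 0 j).
Hypothesis iG : forall u v j, (D i).-integrable setT (fun x => (G u v x 0 j)%:E).
Hypothesis Gg : forall u v j, (\int[D i]_x (G u v x 0 j)%:E)%E = (g u v 0 j)%:E.
Hypothesis Gsig : forall u v,
  (\int[D i]_x (sqnorm (G u v x - g u v))%:E <= (sig ^+ 2)%:E)%E.

Let xi w := local_noise Gu Gv G g gamu gamv (fun l => z t i l w) (u, v) k.
Let p (w : Omega) := local_iter Gu Gv gamu gamv (fun l => z t i l w) (u, v) k.
Let W : measurableType _ := (src (local_past t i k) * src (local_sample t i k))%type.
(** Decoupled form of [xi]: the iterate reads the first copy of [Omega], the fresh sample the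
    second, and [xi] is its restriction to the diagonal. *)
Let xi2 (w : W) := G (p w.1).1 (p w.1).2 (z t i k w.2) - g (p w.1).1 (p w.1).2.

Let disj j : ~~ (local_past t i k j && local_sample t i k j).
Proof.
by apply/negP => /andP[+ /eqP jE]; rewrite jE /= ltnn !andbF.
Qed.

Let mxi2 : vec_measurable xi2.
Proof.
have [p1 p2] : vec_measurable (fun w : W => (p w.1).1) /\
    vec_measurable (fun w : W => (p w.1).2).
  apply: vec_measurable_local_iter => //; try exact: vec_measurable_cst.
  move=> l lk; apply: (measurableT_comp (f := (z t i l : src (local_past t i k) -> Z))) => //.
  by apply: src_sample; rewrite /= !eqxx.
apply: vec_measurableB; last exact: vec_measurable_mean.
apply: vec_measurable_comp3 => //.
apply: (measurableT_comp (f := (z t i k : src (local_sample t i k) -> Z))) => //.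
by apply: src_sample; rewrite /local_sample eqxx.
Qed.

Let mxi : vec_measurable xi.
Proof.
have mz l : measurable_fun setT (z t i l) by exact: zm.
have [p1 p2] : vec_measurable (fun w => (p w).1) /\ vec_measurable (fun w => (p w).2).
  by apply: vec_measurable_local_iter => //; try exact: vec_measurable_cst.
apply: vec_measurableB; last exact: vec_measurable_mean.
exact: vec_measurable_comp3.
Qed.

Lemma noise_sqnorm : mean_le P (fun w => sqnorm (xi w)) (sig ^+ 2).
Proof.
split; [exact: measurable_sqnorm|by move=> w; exact: sqnorm_ge0|].
rewrite -[leLHS]/(\int[P]_w (fun x : W => (sqnorm (xi2 x))%:E) (w, w))%E.
rewrite (src_decouple disj); last 2 first.
- by apply/measurable_EFinP; exact: measurable_sqnorm.
- by move=> x; rewrite lee_fin sqnorm_ge0.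
apply: (@le_trans _ _ (\int[P]_w (sig ^+ 2)%:E)%E); last first.
  by rewrite integral_cst// [X in (_ * X)%E](probability_setT P) mule1.
apply: ge0_le_integralT => w.
  by apply: integral_ge0 => w' _; rewrite lee_fin sqnorm_ge0.
apply: le_trans (Gsig (p w).1 (p w).2).
rewrite -(integral_law (D := D i) (zm t i k) (zD t i k))//.
  apply/measurable_EFinP; apply: measurable_sqnorm.
  apply: vec_measurableB; last exact: vec_measurable_cst.
  by apply: vec_measurable_comp3 => //; exact: vec_measurable_cst.
by move=> x; rewrite lee_fin sqnorm_ge0.
Qed.

(** Decoupling is available for nonnegative integrands, so positive and negative parts are decoupled
    separately. With the iterate frozen their inner integrals agree, the error having mean zero
    under [D i]. Integrability comes from [|x| <= 1 + x^2] and [noise_sqnorm]. *)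
Lemma noise_centered j : centered P (fun w => xi w 0 j).
Proof.
pose e : Omega -> \bar R := EFin \o (fun w => xi w 0 j).
have ixi : P.-integrable setT e.
  have cst : mean_le P (fun=> 1) 1.
    split => //.
    by rewrite integral_cst// [X in (_ * X)%E](probability_setT P) mule1.
  apply: (le_integrable measurableT _ _ (mean_le_integrable (mean_leD cst noise_sqnorm))).
    exact/measurable_EFinP/mxi.
  move=> w _; rewrite /= lee_fin [leRHS]ger0_norm ?addr_ge0 ?sqnorm_ge0//.
  have : (xi w 0 j) ^+ 2 <= sqnorm (xi w).
    rewrite /sqnorm (bigD1 j)//= lerDl sumr_ge0// => l _; exact: sqr_ge0.
  by rewrite -real_normK ?num_real//; have := sqr_ge0 (`|xi w 0 j| - 1); have := sqr_ge0 (`|xi w 0 j|); lra.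
split => //.
pose f (x : W) := (xi2 x 0 j)%:E.
have mf : measurable_fun setT f by apply/measurable_EFinP; exact: (mxi2 j).
have fpE : (\int[P]_w e^\+ w = \int[P]_w f^\+ (w, w))%E.
  by apply: eq_integral => w _; rewrite !funeposE.
have fnE : (\int[P]_w e^\- w = \int[P]_w f^\- (w, w))%E.
  by apply: eq_integral => w _; rewrite !funenegE.
have pfin := integrable_pos_fin_num measurableT ixi.
have nfin := integrable_neg_fin_num measurableT ixi.
suff PN : (\int[P]_w f^\+ (w, w) = \int[P]_w f^\- (w, w))%E.
  rewrite integralE -[X in (X - _)%E]/(\int[P]_w e^\+ w)%E.
  by rewrite fpE PN -fnE subee.
rewrite !(src_decouple disj)//; last 2 first.
- exact: measurable_funeneg.
- exact: measurable_funepos.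
apply: eq_integral => w _.
pose h x := G (p w).1 (p w).2 x 0 j - g (p w).1 (p w).2 0 j.
have mh : measurable_fun setT h.
  apply: measurable_funB => //.
  by apply: (vec_measurable_comp3 mG) => //; exact: vec_measurable_cst.
pose gj : Z -> \bar R := EFin \o (fun=> g (p w).1 (p w).2 0 j).
have c1 : (D i).-integrable setT gj.
  exact: finite_measure_integrable_cst.
have ih : (D i).-integrable setT (EFin \o h).
  exact: (integrableB measurableT (iG (p w).1 (p w).2 j) c1).
have h0 : (\int[D i]_x (EFin \o h) x = 0)%E.
  transitivity (\int[D i]_x ((G (p w).1 (p w).2 x 0 j)%:E - gj x))%E; first by [].
  rewrite (integralB measurableT (iG (p w).1 (p w).2 j) c1) Gg /= integral_cst//.
  by rewrite [X in (_ * X)%E](probability_setT (D i)) mule1 subee.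
transitivity (\int[P]_w' (EFin \o h)^\+ (z t i k w'))%E.
  by apply: eq_integral => w' _; rewrite !funeposE /f /xi2 /h /= !mxE.
transitivity (\int[P]_w' (EFin \o h)^\- (z t i k w'))%E; last first.
  by apply: eq_integral => w' _; rewrite !funenegE /f /xi2 /h /= !mxE.
rewrite !(integral_law (D := D i) (zm t i k) (zD t i k))//; last 2 first.
- by apply: measurable_funeneg; exact/measurable_EFinP.
- by apply: measurable_funepos; exact/measurable_EFinP.
have hp := integrable_pos_fin_num measurableT ih.
have hn := integrable_neg_fin_num measurableT ih.
rewrite -(fineK hp) -(fineK hn); congr _%:E; apply/eqP.
by rewrite -subr_eq0 -eqe EFinB !fineK// -integralE h0.
Qed.

End noise.
End sources.

(** * Convergence *)

Section convergence.
Context {R : realType} {n d0 : nat} {dv : 'I_n -> nat}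
  {dZ : measure_display} {Z : measurableType dZ}
  {dO : measure_display} {Omega : measurableType dO}.
Unset Implicit Arguments.
Variables (m tau : nat) (D : 'I_n -> probability Z R)
  (F : forall i : 'I_n, 'rV[R]_d0 -> 'rV[R]_(dv i) -> R)
  (gu : forall i : 'I_n, 'rV[R]_d0 -> 'rV[R]_(dv i) -> 'rV[R]_d0)
  (gv : forall i : 'I_n, 'rV[R]_d0 -> 'rV[R]_(dv i) -> 'rV[R]_(dv i))
  (Gu : forall i : 'I_n, 'rV[R]_d0 -> 'rV[R]_(dv i) -> Z -> 'rV[R]_d0)
  (Gv : forall i : 'I_n, 'rV[R]_d0 -> 'rV[R]_(dv i) -> Z -> 'rV[R]_(dv i))
  (Fstar Lu Lv Luv Lvu chi sigu sigv delta rho eta : R)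
  (u0 : 'rV[R]_d0) (V0 : forall i : 'I_n, 'rV[R]_(dv i))
  (P : probability Omega R) (Ssel : nat -> Omega -> {set 'I_n})
  (z : nat -> 'I_n -> nat -> Omega -> Z).
Hypotheses (n2 : (2 <= n)%N) (m1 : (1 <= m)%N) (mn : (m <= n)%N) (tau1 : (1 <= tau)%N).
Hypothesis Fu : forall i u v h, is_derive u h (fun x => F i x v) (dotv (gu i u v) h).
Hypothesis Fv : forall i u v h, is_derive v h (fun y => F i u y) (dotv (gv i u v) h).
Hypothesis Fge : forall u V, Fstar <= Fobj F u V.
Hypotheses (Lu0 : 0 < Lu) (Lv0 : 0 < Lv).
Hypothesis guu : forall i u u' v, enorm (gu i u v - gu i u' v) <= Lu * enorm (u - u').
Hypothesis gvv : forall i u v v', enorm (gv i u v - gv i u v') <= Lv * enorm (v - v').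
Hypothesis guv : forall i u v v', enorm (gu i u v - gu i u v') <= Luv * enorm (v - v').
Hypothesis gvu : forall i u u' v, enorm (gv i u v - gv i u' v) <= Lvu * enorm (u - u').
Hypothesis cross : Num.max Luv Lvu <= chi * Num.sqrt (Lu * Lv).
Hypothesis iGu : forall i u v j, (D i).-integrable setT (fun x => (Gu i u v x 0 j)%:E).
Hypothesis iGv : forall i u v j, (D i).-integrable setT (fun x => (Gv i u v x 0 j)%:E).
Hypothesis Gugu : forall i u v j, (\int[D i]_x (Gu i u v x 0 j)%:E)%E = (gu i u v 0 j)%:E.
Hypothesis Gvgv : forall i u v j, (\int[D i]_x (Gv i u v x 0 j)%:E)%E = (gv i u v 0 j)%:E.
Hypothesis Gusig : forall i u v,
  (\int[D i]_x (sqnorm (Gu i u v x - gu i u v))%:E <= (sigu ^+ 2)%:E)%E.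
Hypothesis Gvsig : forall i u v,
  (\int[D i]_x (sqnorm (Gv i u v x - gv i u v))%:E <= (sigv ^+ 2)%:E)%E.
Hypothesis mGu : forall i j, measurable_fun setT
  (fun p : ((d0.-tuple R * (dv i).-tuple R) * Z)%type =>
     Gu i (t2rv p.1.1) (t2rv p.1.2) p.2 0 j).
Hypothesis mGv : forall i j, measurable_fun setT
  (fun p : ((d0.-tuple R * (dv i).-tuple R) * Z)%type =>
     Gv i (t2rv p.1.1) (t2rv p.1.2) p.2 0 j).
Hypothesis diversity : forall u V,
  (n%:R)^-1 * \sum_(i < n) sqnorm (gu i u (V i) - gradFu gu u V) <=
  delta ^+ 2 + rho ^+ 2 * sqnorm (gradFu gu u V).
Hypothesis Sm : forall t S, measurable (Ssel t @^-1` [set S]).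
Hypothesis SP : forall t S, P (Ssel t @^-1` [set S]) =
  (if #|S| == m then ('C(n, m)%:R)^-1 else 0)%:E.
Hypothesis zm : forall t i k, measurable_fun setT (z t i k).
Hypothesis zD : forall t i k B, measurable B -> P (z t i k @^-1` B) = D i B.
Hypothesis indep : mutually_independent P (source_events Ssel z).
Hypothesis eta0 : 0 < eta.
Let K := 1 + chi ^+ 2.
Let Q := 1 + rho ^+ 2.
Let theta : R := 1 - tau%:R^-1.
Let r : R := m%:R / n%:R.
Hypothesis eta_small : 12 * K * Q * eta <= 1.
Hypothesis eta_small2 : 196 * K * Q * eta ^+ 2 * theta <= r.
Set Implicit Arguments.

Let gamu := eta / (Lu * tau%:R).
Let gamv := eta / (Lv * tau%:R).
Let next (S : {set 'I_n}) zs s := fedsim_round Gu Gv m tau gamu gamv S zs s.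
Let traj (w : Omega) (t : nat) :=
  fedsim_traj Gu Gv m tau gamu gamv (fun t => Ssel t w) (fun t i k => z t i k w) (u0, V0) t.
Let zt t w := fun i k => z t i k w.
(** Shifting by [Fstar] makes this nonnegative, as decoupling requires. *)
Let loss (s : fstate R n d0 dv) := Fobj F s.1 s.2 - Fstar.
Let grads (s : fstate R n d0 dv) := Delta_u gu s / Lu + r * (Delta_v gv s / Lv).
Let cu := (3 * K * eta ^+ 2 + 20 * K * eta ^+ 3 * theta) / Lu.
Let cv := (3 * K * eta ^+ 2 * r + 20 * K * eta ^+ 3 * theta) / Lv.
Let bias := 6 * K * eta ^+ 2 * (1 - r) * (delta ^+ 2 / Lu) +
  20 * K * eta ^+ 3 * theta * (delta ^+ 2 / Lu).
Let N := bias + (cu * sigu ^+ 2 + cv * sigv ^+ 2).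

Let loss_ge0 s : 0 <= loss s.
Proof. by rewrite subr_ge0. Qed.

Let n0 : 0 < n%:R :> R.
Proof. by rewrite ltr0n (leq_trans _ n2). Qed.

Let r0 : 0 <= r.
Proof. by rewrite divr_ge0. Qed.

Let r1 : r <= 1.
Proof. by rewrite ler_pdivrMr// mul1r ler_nat. Qed.

Let theta0 : 0 <= theta.
Proof. by rewrite subr_ge0 invf_le1 ?ler1n// ltr0n. Qed.

Let K1 : 1 <= K.
Proof. by rewrite lerDl sqr_ge0. Qed.

Let K0 : 0 <= K. Proof. exact: le_trans K1. Qed.

Let e0 : 0 <= eta. Proof. exact: ltW. Qed.

Let cu0 : 0 <= cu.
Proof. by rewrite divr_ge0 ?(ltW Lu0)// addr_ge0// !mulr_ge0. Qed.

Let cv0 : 0 <= cv.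
Proof. by rewrite divr_ge0 ?(ltW Lv0)// addr_ge0// !mulr_ge0. Qed.

Let Delta_u_ge0 s : 0 <= Delta_u gu s.
Proof. exact: sqnorm_ge0. Qed.

Let Delta_v_ge0 s : 0 <= Delta_v gv s.
Proof.
apply: mulr_ge0; first by rewrite invr_ge0 ltW.
by apply: sumr_ge0 => i _; exact: sqnorm_ge0.
Qed.

Let grads_ge0 s : 0 <= grads s.
Proof.
by apply: addr_ge0; [|apply: mulr_ge0 => //]; apply: divr_ge0 => //; exact: ltW.
Qed.

Section measurability.
Context {dW : measure_display} {W : measurableType dW}.
Variable s : W -> fstate R n d0 dv.
Hypotheses (s1 : vec_measurable (fun w => (s w).1))
           (s2 : forall i, vec_measurable (fun w => (s w).2 i)).

Let mgu i : vec_measurable (fun w => gu i (s w).1 ((s w).2 i)).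
Proof. exact: (vec_measurable_mean (mGu i) (iGu i) (Gugu i)). Qed.

Let mgv i : vec_measurable (fun w => gv i (s w).1 ((s w).2 i)).
Proof. exact: (vec_measurable_mean (mGv i) (iGv i) (Gvgv i)). Qed.

Lemma measurable_state_loss : measurable_fun setT (fun w => loss (s w)).
Proof.
apply: measurable_funB => //; apply: measurable_funM => //.
apply: measurable_bigsum => i.
apply: (measurable_loss Lu0 Lv0 (Fu i) (Fv i) (guu i) (gvv i)) => // x y mx my.
- exact: (vec_measurable_mean (mGu i) (iGu i) (Gugu i)).
- exact: (vec_measurable_mean (mGv i) (iGv i) (Gvgv i)).
Qed.

Lemma measurable_Delta_u : measurable_fun setT (fun w => Delta_u gu (s w)).
Proof.
apply: measurable_sqnorm; apply: vec_measurableZ.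
exact: vec_measurable_sum.
Qed.

Lemma measurable_Delta_v : measurable_fun setT (fun w => Delta_v gv (s w)).
Proof.
apply: measurable_funM => //; apply: measurable_bigsum => i.
exact: measurable_sqnorm.
Qed.

Lemma measurable_grads : measurable_fun setT (fun w => grads (s w)).
Proof.
apply: measurable_funD.
  by apply: measurable_funM => //; exact: measurable_Delta_u.
apply: measurable_funM => //.
by apply: measurable_funM => //; exact: measurable_Delta_v.
Qed.

End measurability.

Let src' (J : pred (nat + (nat * 'I_n * nat))%type) := src Ssel z J.

Lemma measurable_traj t (J : pred (nat + (nat * 'I_n * nat))%type) : (forall j, past t j -> J j) ->
  vec_measurable (fun w : src' J => (traj w t).1) /\
  (forall i, vec_measurable (fun w : src' J => (traj w t).2 i)).
Proof.
elim: t => [|t IH] tJ.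
  by split=> [|i]; exact: vec_measurable_cst.
have [|t1 t2] := IH.
  by move=> [s|[[s i] k]] st; apply: tJ; exact: leqW.
apply: (@vec_measurable_round R dZ Z _ (src' J) n d0 dv Gu Gv m tau gamu gamv
  (Ssel t) (fun w i k => z t i k w) (traj ^~ t)) => //.
- by move=> A; apply: src_selection; apply: tJ => /=.
- by move=> i k; apply: src_sample; apply: tJ => /=.
Qed.

Let past_round t (j : (nat + (nat * 'I_n * nat))%type) : ~~ (past t j && at_round t j).
Proof.
by case: j => [s|[[s i] k]]; apply/negP => /andP[/= + /eqP E]; rewrite E ltnn.
Qed.

Let samples_selection t (j : (nat + (nat * 'I_n * nat))%type) :
  ~~ (samples t j && selection t j).
Proof. by case: j => [s|[[s i] k]] //=; rewrite andbF. Qed.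

(** The state is a constant here. Decoupling puts the selection in the inner integral, which becomes
    [subset_avg] and lets [round_avg] act for fixed samples. *)
Lemma round_mean t s :
  (\int[P]_w (loss (next (Ssel t w) (zt t w) s))%:E <=
   (loss s - eta / 4 * grads s + N)%:E)%E.
Proof.
pose f (x : src' (samples t) * src' (selection t)) :=
  (loss (next (Ssel t x.2) (zt t x.1) s))%:E.
have mf : measurable_fun setT f.
  have [| |p1 p2] := @vec_measurable_round R dZ Z _ _ n d0 dv Gu Gv m tau gamu gamv
    (fun x : src' (samples t) * src' (selection t) => Ssel t x.2)
    (fun x => zt t x.1) (fun=> s) mGu mGv _ _ (vec_measurable_cst _)
    (fun i => vec_measurable_cst _).
  - by move=> A; apply: src_selection_comp => /=.
  - move=> i k; apply: (measurableT_comp (f := (z t i k : src' (samples t) -> Z))) => //.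
    by apply: src_sample => /=.
  by apply/measurable_EFinP; exact: measurable_state_loss.
rewrite -[leLHS]/(\int[P]_w f (w, w))%E.
rewrite (src_decouple Sm zm indep (@samples_selection t))//; last by move=> x; rewrite lee_fin.
pose lin w := noise_lin gu gv Gu Gv m tau Lu Lv eta (zt t w) s.
pose quad w := noise_quad gu gv Gu Gv m tau K Lu Lv eta (zt t w) s.
have clin : centered P lin.
  apply: centeredZ; apply: centered_sum => i; apply: centeredZ; apply: centered_sum => k.
  apply: centeredB; apply: centeredZ; apply: centered_sum => j; apply: centeredZ.
  - exact: (noise_centered Sm zm zD indep t k gamu gamv s.1 (s.2 i) (mGu i) (mGv i) (mGu i) (iGu i) (Gugu i) (Gusig i)).
  - exact: (noise_centered Sm zm zD indep t k gamu gamv s.1 (s.2 i) (mGu i) (mGv i) (mGv i) (iGv i) (Gvgv i) (Gvsig i)).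
have mquad : mean_le P quad (cu * sigu ^+ 2 + cv * sigv ^+ 2).
  have -> : cu * sigu ^+ 2 + cv * sigv ^+ 2 = n%:R^-1 * \sum_(i < n) (tau%:R^-1 *
      \sum_(k < tau) (cu * sigu ^+ 2 + cv * sigv ^+ 2)).
    set q := (_ + _ in LHS); rewrite !sumr_const !card_ord -[q *+ tau]mulr_natl.
    by rewrite mulKf ?gt_eqF ?ltr0n// -[q *+ n]mulr_natl mulKf ?gt_eqF.
  apply: mean_leZ; first by rewrite invr_ge0 ltW.
  apply: mean_le_sum => i; apply: mean_leZ; first by rewrite invr_ge0.
  apply: mean_le_sum => k; apply: mean_leD; apply: mean_leZ => //.
  - exact: (noise_sqnorm Sm zm zD indep t k gamu gamv s.1 (s.2 i) (mGu i) (mGv i) (mGu i) (iGu i) (Gugu i) (Gusig i)).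
  - exact: (noise_sqnorm Sm zm zD indep t k gamu gamv s.1 (s.2 i) (mGu i) (mGv i) (mGv i) (iGv i) (Gvgv i) (Gvsig i)).
pose c := loss s - eta / 4 * grads s + bias.
have step w : subset_avg m (fun S => loss (next S (zt t w) s)) <= c + lin w + quad w.
  rewrite /loss subset_avgD subset_avg_cst//.
  have := @round_avg R Z n d0 dv F gu gv Gu Gv m tau K Q Lu Lv eta delta rho n2 m1 mn tau1
    Lu0 Lv0 K1 eta0 erefl (fun i => joint_descent Lu0 Lv0 (Fu i) (Fv i) (guu i) (gvv i) (guv i) cross)
    (fun i => gradu_joint_lip Lu0 Lv0 (guu i) (guv i) cross)
    (fun i => gradv_joint_lip Lu0 Lv0 (gvv i) (gvu i) cross) diversity eta_small eta_small2
    (zt t w) s.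
  rewrite -/gamu -/gamv -/theta -/r -[subset_avg m _]/(subset_avg m (fun S =>
    Fobj F (next S (zt t w) s).1 (next S (zt t w) s).2)).
  rewrite -/(lin w) -/(quad w) /c /bias /loss /grads.
  by lra.
apply: (@le_trans _ _ (\int[P]_w (c + lin w + quad w)%:E)%E).
  apply: ge0_le_integralT => w; first by apply: integral_ge0 => w' _; rewrite lee_fin.
  by rewrite (selection_mean Sm SP t (f := fun S => loss (next S (zt t w) s)))// lee_fin.
apply: (le_trans (integral_affine c clin mquad)).
by rewrite lee_fin /c /N; lra.
Qed.

Let mtraj t : vec_measurable (fun w : Omega => (traj w t).1) /\
  (forall i, vec_measurable (fun w : Omega => (traj w t).2 i)).
Proof.
have [t1 t2] := @measurable_traj t (past t) (fun _ => id).
split=> [j|i j].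
- exact: (src_measurable Sm zm (t1 j)).
- exact: (src_measurable Sm zm (t2 i j)).
Qed.

(** The gradient term stands on the left, so that no extended-real integrals are subtracted. *)
Lemma expected_descent t :
  (\int[P]_w (loss (traj w t.+1))%:E + \int[P]_w (eta / 4 * grads (traj w t))%:E <=
   \int[P]_w (loss (traj w t))%:E + N%:E)%E.
Proof.
pose f (x : src' (past t) * src' (at_round t)) :=
  (loss (next (Ssel t x.2) (zt t x.2) (traj x.1 t)))%:E.
have mf : measurable_fun setT f.
  have [t1 t2] := @measurable_traj t (past t) (fun _ => id).
  have [| | | |p1 p2] := @vec_measurable_round R dZ Z _ _ n d0 dv Gu Gv m tau gamu gamv
    (fun x : src' (past t) * src' (at_round t) => Ssel t x.2)
    (fun x => zt t x.2) (fun x => traj x.1 t) mGu mGv _ _ _ _.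
  - by move=> A; apply: src_selection_comp => /=.
  - move=> i k; apply: (measurableT_comp (f := (z t i k : src' (at_round t) -> Z))) => //.
    by apply: src_sample => /=.
  - by move=> j; exact: (measurableT_comp (t1 j)).
  - by move=> i j; exact: (measurableT_comp (t2 i j)).
  by apply/measurable_EFinP; exact: measurable_state_loss.
have [t1 t2] := mtraj t.
have mg : measurable_fun setT (fun w => eta / 4 * grads (traj w t)).
  by apply: measurable_funM => //; exact: measurable_grads.
have ml : measurable_fun setT (fun w => loss (traj w t)) by exact: measurable_state_loss.
pose psi w := loss (traj w t) - eta / 4 * grads (traj w t) + N.
have le_psi w : (\int[P]_w' f (w, w') <= (psi w)%:E)%E by exact: (round_mean t (traj w t)).
(* Although [psi] contains a difference, it dominates an integral of a nonnegative function; this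
   allows additivity for nonnegative integrals below. *)
have psi0 w : 0 <= psi w.
  rewrite -lee_fin; apply: le_trans (le_psi w).
  by apply: integral_ge0 => w' _; rewrite lee_fin.
have g0 w : 0 <= eta / 4 * grads (traj w t) by rewrite mulr_ge0// divr_ge0.
have N0 : 0 <= N.
  rewrite /N /bias !addr_ge0//; try (by apply: mulr_ge0 => //; exact: sqr_ge0).
    by rewrite mulr_ge0 ?divr_ge0 ?sqr_ge0 ?(ltW Lu0)// !mulr_ge0// subr_ge0.
  by rewrite mulr_ge0 ?divr_ge0 ?sqr_ge0 ?(ltW Lu0)// !mulr_ge0.
apply: (@le_trans _ _ (\int[P]_w (psi w)%:E + \int[P]_w (eta / 4 * grads (traj w t))%:E)%E).
  rewrite leeD2r// -[leLHS]/(\int[P]_w f (w, w))%E.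
  rewrite (src_decouple Sm zm indep (@past_round t))//; last by move=> x; rewrite lee_fin.
  by apply: ge0_le_integralT => // w; apply: integral_ge0 => w' _; rewrite lee_fin.
have mpsi : measurable_fun setT psi.
  by apply: measurable_funD => //; exact: measurable_funB.
rewrite -ge0_integralD//; last 4 first.
- by move=> w _; rewrite lee_fin.
- exact/measurable_EFinP.
- by move=> w _; rewrite lee_fin.
- exact/measurable_EFinP.
rewrite (_ : N%:E = \int[P]_w N%:E)%E; last first.
  by rewrite integral_cst// [X in (_ * X)%E](probability_setT P) mule1.
rewrite -ge0_integralD//; last 2 first.
- by move=> w _; rewrite lee_fin.
- exact/measurable_EFinP.
rewrite le_eqVlt; apply/orP; left; apply/eqP; apply: eq_integral => w _.
by rewrite -!EFinD /psi; congr _%:E; ring.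
Qed.

Lemma expected_telescope t :
  (\int[P]_w (loss (traj w t))%:E +
     \sum_(s < t) \int[P]_w (eta / 4 * grads (traj w s))%:E <=
   (Fobj F u0 V0 - Fstar + t%:R * N)%:E)%E.
Proof.
elim: t => [|t IH].
  rewrite big_ord0 adde0 mul0r addr0.
  rewrite -[leLHS]/(\int[P]_w cst (Fobj F u0 V0 - Fstar)%:E w)%E.
  by rewrite integral_cst// [X in (_ * X)%E](probability_setT P) mule1.
rewrite big_ord_recr/= addeA addeAC.
apply: (le_trans (leeD2r _ (expected_descent t))).
rewrite addeAC -[t.+1%:R]natr1 mulrDl mul1r addrA [leRHS]EFinD.
exact: leeD2r.
Qed.

Lemma expected_grads t :
  ((Lu^-1)%:E * \int[P]_w (Delta_u gu (traj w t))%:E +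
   (m%:R / (n%:R * Lv))%:E * \int[P]_w (Delta_v gv (traj w t))%:E =
   (4 / eta)%:E * \int[P]_w (eta / 4 * grads (traj w t))%:E)%E.
Proof.
have [t1 t2] := mtraj t.
have Lui : 0 <= Lu^-1 by rewrite invr_ge0 ltW.
have rv : 0 <= m%:R / (n%:R * Lv) by rewrite divr_ge0// mulr_ge0// ltW.
have mg : measurable_fun setT (fun w => eta / 4 * grads (traj w t)).
  by apply: measurable_funM => //; exact: measurable_grads.
have mdu := measurable_Delta_u t1 t2.
have mdv := measurable_Delta_v t1 t2.
have du0 w : setT w -> (0 <= (Delta_u gu (traj w t))%:E)%E by rewrite lee_fin.
have dv0 w : setT w -> (0 <= (Delta_v gv (traj w t))%:E)%E by rewrite lee_fin.
have g0 w : setT w -> (0 <= (eta / 4 * grads (traj w t))%:E)%E.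
  by move=> _; rewrite lee_fin mulr_ge0// divr_ge0.
have e4 : 0 <= 4 / eta by rewrite divr_ge0.
rewrite -!ge0_integralZl//; try exact/measurable_EFinP.
rewrite -ge0_integralD//.
- apply: eq_integral => w _; rewrite -!EFinM -EFinD /grads /r; congr _%:E.
  by field; rewrite !gt_eqF.
- by move=> w _; rewrite mule_ge0 ?lee_fin.
- by apply/measurable_EFinP; exact: measurable_funM.
- by move=> w _; rewrite mule_ge0 ?lee_fin.
- by apply/measurable_EFinP; exact: measurable_funM.
Qed.

Lemma convergence_rate T : (1 <= T)%N ->
  ((T%:R)^-1%:E * \sum_(t < T) ((Lu^-1)%:E * \int[P]_w (Delta_u gu (traj w t))%:E
       + (m%:R / (n%:R * Lv))%:E * \int[P]_w (Delta_v gv (traj w t))%:E)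
    <= (80%:R * ((Fobj F u0 V0 - Fstar) / (eta * T%:R) + eta * ((1 + chi ^+ 2) * (delta ^+ 2 / Lu * (1 - m%:R / n%:R)
                + sigu ^+ 2 / Lu + sigv ^+ 2 * m%:R / (Lv * n%:R))) +
        eta ^+ 2 * ((1 + chi ^+ 2) * (delta ^+ 2 / Lu + sigu ^+ 2 / Lu + sigv ^+ 2 / Lv)
                * (1 - (tau%:R)^-1))))%:E)%E.
Proof.
move=> T1; set sig1 := (X in _ / _ + eta * X + _); set sig2 := (X in eta ^+ 2 * X).
have T0 : 0 < T%:R :> R by rewrite ltr0n.
under eq_bigr do rewrite expected_grads.
have I0 t : (0 <= \int[P]_w (eta / 4 * grads (traj w t))%:E)%E.
  by apply: integral_ge0 => w _; rewrite lee_fin mulr_ge0// divr_ge0.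
rewrite -ge0_sume_distrr//.
have tele : (\sum_(t < T) \int[P]_w (eta / 4 * grads (traj w t))%:E <=
    (Fobj F u0 V0 - Fstar + T%:R * N)%:E)%E.
  apply: le_trans (expected_telescope T); apply: leeDr.
  by apply: integral_ge0 => w _; rewrite lee_fin.
rewrite muleA -EFinM.
have c0 : 0 <= T%:R^-1 * (4 / eta) by rewrite mulr_ge0 ?invr_ge0// divr_ge0.
apply: (le_trans (lee_wpmul2l _ tele)); first by rewrite lee_fin.
rewrite -EFinM lee_fin.
have DF0 : 0 <= (Fobj F u0 V0 - Fstar) / (eta * T%:R).
  by rewrite divr_ge0 ?subr_ge0// mulr_ge0.
have y0 (b x : R) : 0 < b -> 0 <= x ^+ 2 / b.
  by move=> b0; rewrite divr_ge0 ?sqr_ge0// ltW.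
(* The error terms of the claim, one summand each. Dividing by [eta / 4] gives them the coefficients
   [4 * 6], [4 * 3], [4 * 3] and [4 * 20], and the initial gap [4]; the constant [80] is the
   largest. *)
pose x1 := eta * K * (1 - r) * (delta ^+ 2 / Lu).
pose x2 := eta * K * (sigu ^+ 2 / Lu).
pose x3 := eta * K * r * (sigv ^+ 2 / Lv).
pose x4 := eta ^+ 2 * K * theta * (delta ^+ 2 / Lu + sigu ^+ 2 / Lu + sigv ^+ 2 / Lv).
have x10 : 0 <= x1 by apply: mulr_ge0; [rewrite !mulr_ge0 ?subr_ge0|exact: y0].
have x20 : 0 <= x2 by apply: mulr_ge0; [rewrite !mulr_ge0|exact: y0].
have x30 : 0 <= x3 by apply: mulr_ge0; [rewrite !mulr_ge0|exact: y0].
have x40 : 0 <= x4.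
  by apply: mulr_ge0; [rewrite !mulr_ge0|apply: addr_ge0; [apply: addr_ge0|]; exact: y0].
have s1E : eta * sig1 = x1 + x2 + x3.
  by rewrite /sig1 /x1 /x2 /x3 /r /K; field; rewrite !gt_eqF.
have s2E : eta ^+ 2 * sig2 = x4 by rewrite /sig2 /x4 /theta /K; ring.
rewrite s1E s2E.
have -> : T%:R^-1 * (4 / eta) * (Fobj F u0 V0 - Fstar + T%:R * N) =
    4 * ((Fobj F u0 V0 - Fstar) / (eta * T%:R)) + 4 * (6 * x1 + 3 * x2 + 3 * x3 + 20 * x4).
  rewrite /N /bias /cu /cv /x1 /x2 /x3 /x4.
  by field; rewrite !gt_eqF.
by lra.
Qed.

End convergence.

Theorem theorem5 :
  exists C : nat, (0 < C)%N /\
  forall (R : realType)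
    (* (S) setup: devices, data distributions, losses, stochastic gradients *)
    (n m T tau d0 : nat) (dv : 'I_n -> nat)
    (dZ : measure_display) (Z : measurableType dZ)
    (D : 'I_n -> probability Z R)
    (F : forall i : 'I_n, 'rV[R]_d0 -> 'rV[R]_(dv i) -> R)
    (gu : forall i : 'I_n, 'rV[R]_d0 -> 'rV[R]_(dv i) -> 'rV[R]_d0)
    (gv : forall i : 'I_n, 'rV[R]_d0 -> 'rV[R]_(dv i) -> 'rV[R]_(dv i))
    (Gu : forall i : 'I_n, 'rV[R]_d0 -> 'rV[R]_(dv i) -> Z -> 'rV[R]_d0)
    (Gv : forall i : 'I_n, 'rV[R]_d0 -> 'rV[R]_(dv i) -> Z -> 'rV[R]_(dv i))
    (Fstar Lu Lv Luv Lvu chi sigu sigv delta rho eta : R)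
    (u0 : 'rV[R]_d0) (V0 : forall i : 'I_n, 'rV[R]_(dv i))
    (* the underlying probability space carrying all the randomness *)
    (dO : measure_display) (Omega : measurableType dO) (P : probability Omega R)
    (Ssel : nat -> Omega -> {set 'I_n})
    (z : nat -> 'I_n -> nat -> Omega -> Z),
    (2 <= n)%N -> (1 <= m <= n)%N -> (1 <= T)%N -> (1 <= tau)%N ->
    (* gu i, gv i are the partial gradients of F i *)
    (forall i u v h, is_derive u h (fun x => F i x v) (dotv (gu i u v) h)) ->
    (forall i u v h, is_derive v h (fun y => F i u y) (dotv (gv i u v) h)) ->
    (* F bounded below by Fstar *)
    (forall u V, Fstar <= Fobj F u V) ->
    (* (A1) smoothness *)
    0 < Lu -> 0 < Lv -> 0 < chi ->
    (forall i u u' v, enorm (gu i u v - gu i u' v) <= Lu * enorm (u - u')) ->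
    (forall i u v v', enorm (gv i u v - gv i u v') <= Lv * enorm (v - v')) ->
    (forall i u v v', enorm (gu i u v - gu i u v') <= Luv * enorm (v - v')) ->
    (forall i u u' v, enorm (gv i u v - gv i u' v) <= Lvu * enorm (u - u')) ->
    Num.max Luv Lvu <= chi * Num.sqrt (Lu * Lv) ->
    (* (A2) unbiased stochastic gradients with bounded variance *)
    (forall i u v j, (D i).-integrable setT (fun x => (Gu i u v x 0 j)%:E)) ->
    (forall i u v j, (D i).-integrable setT (fun x => (Gv i u v x 0 j)%:E)) ->
    (forall i u v j, (\int[D i]_x (Gu i u v x 0 j)%:E)%E = (gu i u v 0 j)%:E) ->
    (forall i u v j, (\int[D i]_x (Gv i u v x 0 j)%:E)%E = (gv i u v 0 j)%:E) ->
    (forall i u v,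
        (\int[D i]_x (sqnorm (Gu i u v x - gu i u v))%:E <= (sigu ^+ 2)%:E)%E) ->
    (forall i u v,
        (\int[D i]_x (sqnorm (Gv i u v x - gv i u v))%:E <= (sigv ^+ 2)%:E)%E) ->
    (* stochastic gradients are jointly (Borel x Z) measurable *)
    (forall i j, measurable_fun setT
        (fun p : ((d0.-tuple R * (dv i).-tuple R) * Z)%type =>
           Gu i (t2rv p.1.1) (t2rv p.1.2) p.2 0 j)) ->
    (forall i j, measurable_fun setT
        (fun p : ((d0.-tuple R * (dv i).-tuple R) * Z)%type =>
           Gv i (t2rv p.1.1) (t2rv p.1.2) p.2 0 j)) ->
    (* (A3) partial gradient diversity *)
    (forall u V, (n%:R)^-1 * \sum_(i < n) sqnorm (gu i u (V i) - gradFu gu u V)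
                 <= delta ^+ 2 + rho ^+ 2 * sqnorm (gradFu gu u V)) ->
    (* FedSim randomness: S^(t) uniform among m-subsets, z_{t,i,k} ~ D i,
       all of them mutually independent *)
    (forall t S, measurable (Ssel t @^-1` [set S])) ->
    (forall t S, P (Ssel t @^-1` [set S]) =
                 (if #|S| == m then ('C(n, m)%:R)^-1 else 0)%:E) ->
    (forall t i k, measurable_fun setT (z t i k)) ->
    (forall t i k B, measurable B -> P (z t i k @^-1` B) = D i B) ->
    mutually_independent P
      (fun j : (nat + (nat * 'I_n * nat))%type =>
         match j with
         | inl t => rv_events (Ssel t) setT
         | inr tik => rv_events (z tik.1.1 tik.1.2 tik.2) measurable
         end) ->
    (* step-size condition *)
    0 < eta ->
    eta <= (12 * (1 + chi ^+ 2) * (1 + rho ^+ 2))^-1 ->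
    ((1 < tau)%N -> eta <= Num.sqrt ((m%:R / n%:R) /
          (196 * (1 - (tau%:R)^-1) * (1 + chi ^+ 2) * (1 + rho ^+ 2)))) ->
    let gamu := eta / (Lu * tau%:R) in
    let gamv := eta / (Lv * tau%:R) in
    let traj (w : Omega) (t : nat) :=
      fedsim_traj Gu Gv m tau gamu gamv (fun t => Ssel t w)
        (fun t i k => z t i k w) (u0, V0) t in
    let EDu t := (\int[P]_w (Delta_u gu (traj w t))%:E)%E in
    let EDv t := (\int[P]_w (Delta_v gv (traj w t))%:E)%E in
    let DeltaF0 := Fobj F u0 V0 - Fstar in
    let sig1 := (1 + chi ^+ 2) * (delta ^+ 2 / Lu * (1 - m%:R / n%:R)
                  + sigu ^+ 2 / Lu + sigv ^+ 2 * m%:R / (Lv * n%:R)) in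
    let sig2 := (1 + chi ^+ 2) * (delta ^+ 2 / Lu + sigu ^+ 2 / Lu + sigv ^+ 2 / Lv)
                  * (1 - (tau%:R)^-1) in
    ((T%:R)^-1%:E * \sum_(t < T) ((Lu^-1)%:E * EDu t
                                 + (m%:R / (n%:R * Lv))%:E * EDv t)
      <= (C%:R * (DeltaF0 / (eta * T%:R) + eta * sig1 + eta ^+ 2 * sig2))%:E)%E.
Proof.
exists 80%N; split=> // R n m T tau d0 dv dZ Z D F gu gv Gu Gv Fstar Lu Lv Luv Lvu chi
  sigu sigv delta rho eta u0 V0 dO Omega P Ssel z n2 /andP[m1 mn] T1 tau1 Fu Fv Fge
  Lu0 Lv0 chi0 guu gvv guv gvu cross iGu iGv Gugu Gvgv Gusig Gvsig mGu mGv diversity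
  Sm SP zm zD indep eta0 eta_le eta_le2.
have K0 : 0 < 1 + chi ^+ 2 by rewrite ltr_pwDl// sqr_ge0.
have Q0 : 0 < 1 + rho ^+ 2 by rewrite ltr_pwDl// sqr_ge0.
have KQ0 : 0 < 12 * (1 + chi ^+ 2) * (1 + rho ^+ 2) by rewrite !mulr_gt0.
have eta_small : 12 * (1 + chi ^+ 2) * (1 + rho ^+ 2) * eta <= 1.
  by rewrite -ler_pdivlMl// mulr1.
have eta_small2 : 196 * (1 + chi ^+ 2) * (1 + rho ^+ 2) * eta ^+ 2 * (1 - tau%:R^-1) <=
    m%:R / n%:R.
  (* The squared form of the second step-size condition also covers [tau = 1], where [1 - 1/tau] is
     zero and the condition is void. *)
  have [tau2|] := ltnP 1 tau; last first.
    move=> tau_le; have -> : tau = 1%N by apply/eqP; rewrite eqn_leq tau_le.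
    by rewrite invr1 subrr mulr0 divr_ge0.
  have th0 : 0 < 1 - tau%:R^-1 :> R by rewrite subr_gt0 invf_lt1 ?ltr1n// ltr0n.
  have Y0 : 0 < 196 * (1 - tau%:R^-1) * (1 + chi ^+ 2) * (1 + rho ^+ 2) by rewrite !mulr_gt0.
  have : eta ^+ 2 <= (m%:R / n%:R) /
      (196 * (1 - tau%:R^-1) * (1 + chi ^+ 2) * (1 + rho ^+ 2)).
    rewrite -[leRHS]sqr_sqrtr; last by rewrite divr_ge0 ?(ltW Y0)// divr_ge0.
    by rewrite ler_sqr ?nnegrE ?sqrtr_ge0 ?(ltW eta0)// eta_le2.
  by rewrite ler_pdivlMr//; lra.
exact: (convergence_rate u0 V0 n2 m1 mn tau1 Fu Fv Fge Lu0 Lv0 guu gvv guv gvu cross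
  iGu iGv Gugu Gvgv Gusig Gvsig mGu mGv diversity Sm SP zm zD indep eta0
  eta_small eta_small2 T1).
Qed.
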